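(* Let $q=16$, let $c_0\in(1,q)$ be a zero of the function $H_q(c)=\sum_{n\in\mathbb Z}(-1)^nq^{n/2}e^{-cq^n}$ ($c>0$), and let $$B_m=\{c_0q^m+\ell q^{-2m}:1\le\ell\le q^m\}\ (m\ge0,\ \ell\in\mathbb N),\qquad T=\{0\}\cup\bigcup_{m\ge0}B_m .$$ Then $T$ satisfies $0\in T$, $N_T(R)\asymp R$ as $R\to\infty$, and $(1-r^2)\sum_{t\in T}r^{2t}\asymp1$ for $0<r<1$, but $T\notin\mathfrak U$.
   Context: $\mathbb N=\{0,1,2,\dots\}$. The series defining $H_q$ converges absolutely on $(0,\infty)$ and $H_q$ does have a zero in $(1,q)$, so such a $c_0$ exists; the set $T$ is locally finite. A set $T\subset[0,\infty)$ is locally finite if $T\cap[0,R]$ is finite for every $R>0$; $N_T(R)=\#(T\cap[0,R])$. $N_T(R)\asymp R$ as $R\to\infty$ means that for some $0<c\le c'<\infty$ and $R_0>0$, $cR\le N_T(R)\le c'R$ for $R\ge R_0$; $f(r)\asymp1$ for $0<r<1$ means that $f$ is bounded above and below on $(0,1)$ by positive finite constants. For a positive operator $A$ on a Hilbert space, $A^t$ is defined by continuous functional calculus for $t>0$ and $A^0=I$. The family $\{CA^t\}_{t\in T}$ is exactly observable if there are $0<a\le b<\infty$ with $a\|x\|^2\le\sum_{t\in T}\|CA^tx\|^2\le b\|x\|^2$ for all $x\in H$. $\mathfrak U$ is the class of universal time sets: locally finite $T\subset[0,\infty)$ such that for all separable complex Hilbert spaces $H,Y$, every positive $A\in\mathcal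 B(H)$ and every $C\in\mathcal B(H,Y)$, exact observability of $\{CA^n\}_{n\in\mathbb N}$ implies exact observability of $\{CA^t\}_{t\in T}$. *)

(* Defs.v *)
From HB Require Import structures.
From mathcomp Require Import all_boot all_order all_algebra.
From mathcomp Require Import sesquilinear.
From mathcomp Require Import finmap complex.
From mathcomp Require Import all_classical all_reals all_analysis.
Set Implicit Arguments.
Unset Strict Implicit.
Unset Printing Implicit Defensive.
Import Order.TTheory GRing.Theory Num.Theory.
Import numFieldNormedType.Exports.
Local Open Scope classical_set_scope.
Local Open Scope complex_scope.
Local Open Scope ring_scope.

(* A complex Hilbert space: the norm is the one induced by the inner product,
   which is linear in its first argument and antilinear in its second. *)
Record hilbertSpace (R : realType) := HilbertSpace {
  hcarrier :> completeNormedModType R[i];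
  hdot : {dot hcarrier for (Num.conj : R[i] -> R[i])};
  hdotxx : forall x : hcarrier, hdot x x = `|x| ^+ 2
}.

Definition separable_space (T : topologicalType) : Prop :=
  exists2 D : set T, countable D & dense D.

(* The norm of a normed module over R[i] takes its values in R[i]; these are
   nonnegative reals, and rnorm x is `|x| seen as an element of R. *)
Definition rnorm (R : realType) (V : normedModType R[i]) (x : V) : R :=
  complex.Re `|x|.

Section Operators.
Variable R : realType.

Definition bounded_op (V W : normedModType R[i]) (A : V -> W) : Prop :=
  linear A /\ continuous A.

Definition positive_op (H : hilbertSpace R) (A : H -> H) : Prop :=
  bounded_op A /\ forall x, 0 <= hdot H (A x) x.

Definition spectrum (V : normedModType R[i]) (A : V -> V) : set R[i] :=
  [set z | ~ exists B : V -> V, [/\ bounded_op B,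
     forall x, B (A x - z *: x) = x & forall x, A (B x) - z *: B x = x]].

Definition continuous_on_spectrum (V : normedModType R[i]) (A : V -> V)
    (f : R[i] -> R[i]) : Prop :=
  {within (spectrum A : set R[i]^o), continuous (f : R[i]^o -> R[i]^o)}.

(* Phi is the continuous functional calculus of the self-adjoint operator A:
   the unital *-homomorphism C(spectrum A) -> B(H) that is contractive for the
   supremum norm and maps the identity function to A.  By the spectral theorem
   there is exactly one.  An element of C(spectrum A) is represented by any
   function on R[i] continuous on spectrum A; cfc_norm makes Phi f depend on the
   values of f on the spectrum only.  Nothing is required of Phi f for other f. *)
Record is_cfc (H : hilbertSpace R) (A : H -> H)
    (Phi : (R[i] -> R[i]) -> H -> H) : Prop := IsCfc {
  cfc_bounded : forall f, continuous_on_spectrum A f -> bounded_op (Phi f);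
  cfc_one : forall x, Phi (fun=> 1) x = x;
  cfc_id : forall x, Phi id x = A x;
  cfc_scale : forall (a : R[i]) f, continuous_on_spectrum A f ->
    forall x, Phi (fun z => a * f z) x = a *: Phi f x;
  cfc_add : forall f g, continuous_on_spectrum A f ->
    continuous_on_spectrum A g ->
    forall x, Phi (fun z => f z + g z) x = Phi f x + Phi g x;
  cfc_mul : forall f g, continuous_on_spectrum A f ->
    continuous_on_spectrum A g ->
    forall x, Phi (fun z => f z * g z) x = Phi f (Phi g x);
  cfc_adj : forall f, continuous_on_spectrum A f ->
    forall x y, hdot H (Phi f x) y = hdot H x (Phi (fun z => (f z)^*) y);
  cfc_norm : forall f g (M : R), continuous_on_spectrum A f ->
    continuous_on_spectrum A g ->
    (forall z, spectrum A z -> `|f z - g z| <= M%:C) ->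
    forall x, `|Phi f x - Phi g x| <= M%:C * `|x|
}.

(* A^t, for A positive with functional calculus Phi and t >= 0.  The spectrum
   of A lies in [0, +oo), so that Re z is z on the spectrum. *)
Definition op_pow (H : hilbertSpace R) (Phi : (R[i] -> R[i]) -> H -> H)
    (t : R) : H -> H :=
  if t == 0 then id else Phi (fun z => ((complex.Re z) `^ t)%:C).

Definition exactly_observable (H Y : hilbertSpace R) (F : R -> H -> Y)
    (T : set R) : Prop :=
  exists a b : R, [/\ 0 < a, a <= b & forall x : H,
    ((a * rnorm x ^+ 2)%:E <= \esum_(t in T) (rnorm (F t x) ^+ 2)%:E)%E /\
    (\esum_(t in T) (rnorm (F t x) ^+ 2)%:E <= (b * rnorm x ^+ 2)%:E)%E].

Definition locally_finite (T : set R) : Prop :=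
  T `<=` [set t | 0 <= t] /\
  forall r : R, 0 < r -> finite_set (T `&` `[0, r]).

Definition natural_times : set R := range (fun n : nat => n%:R).

Definition universal_time_sets : set (set R) :=
  [set T | locally_finite T /\
    forall (H Y : hilbertSpace R) (A : H -> H) (C : H -> Y)
           (Phi : (R[i] -> R[i]) -> H -> H),
      separable_space H -> separable_space Y ->
      positive_op A -> bounded_op C -> is_cfc A Phi ->
      exactly_observable (fun t x => C (op_pow Phi t x)) natural_times ->
      exactly_observable (fun t x => C (op_pow Phi t x)) T].

(* Only meaningful for T locally finite: fset_set of an infinite set is empty. *)
Definition counting_function (T : set R) (r : R) : nat :=
  #|` fset_set (T `&` `[0, r]) |.

End Operators.

Section TimeSet.
Variable R : realType.

Definition Hq_term (q c : R) (n : int) : R :=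
  (-1) ^ n * q `^ (n%:~R / 2) * expR (- (c * q ^ n)).

(* The series converges absolutely for q > 1 and c > 0; the sum over the
   integers is split into n >= 0 and n < 0. *)
Definition Hq (q c : R) : R :=
  limn (series (fun k : nat => Hq_term q c k%:Z)) +
  limn (series (fun k : nat => Hq_term q c (- k.+1%:Z))).

Definition block (q : nat) (c0 : R) (m : nat) : set R :=
  [set c0 * q%:R ^+ m + l%:R * q%:R ^- (2 * m) | l in [set l | (1 <= l <= q ^ m)%N]].

Definition time_set (q : nat) (c0 : R) : set R :=
  [set 0] `|` \bigcup_m block q c0 m.

End TimeSet.

(* Main.v *)
(** A diagonal operator [A] on [l2] with eigenvalues [exp (- 16^-(k+1))] and the
    rank-one observation [C x = (sum_k 4^-(k+1) x_k) e_0] give the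
    counterexample.

    Over the natural numbers the observability Gramian is the matrix
    [c_k c_l / (1 - lam_k lam_l)], where [c_k = 4^-(k+1)] and
    [lam_k = exp (- 16^-(k+1))], which differs from the Toeplitz matrix
    [1 / (4^d + 4^-d)], [d = |k - l|], by an entrywise small term; up to a
    diagonally dominant remainder the Toeplitz matrix is the sum of a positive
    banded Gram matrix and a positive multiple of the identity, so the Gramian
    is bounded above and below.

    For [x = sum_(k < K) (-1)^k e_k], of squared norm [K], the observation at
    time [c0 16^m] is, up to sign, [4^-m] times a window of the series defining
    [H_16 (c0) = 0]; what is missing from the full series decays geometrically
    in [m] and in [|K - m|].  The points of the [m]-th block are so close to
    [c0 16^m] that this persists on the whole block, and since a block has
    [16^m] points the sum over [T] stays bounded uniformly in [K]. *)
From HB Require Import structures.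
Require Import Defs.
From mathcomp Require Import all_boot all_order all_algebra.
From mathcomp Require Import sesquilinear ring lra zify.
From mathcomp Require Import finmap complex.
From mathcomp Require Import all_classical all_reals all_analysis.
Import Order.TTheory GRing.Theory Num.Theory.
Import numFieldNormedType.Exports.
Local Open Scope classical_set_scope.
Local Open Scope ring_scope.
Set Implicit Arguments.
Unset Strict Implicit.
Unset Printing Implicit Defensive.

(** * The Hilbert space l2 *)

(** Multiplying the time by 16 shifts the index of the eigenvalues by one, which is the identity
    [H_16 (16 c) = - H_16 (c) / 4]: a single zero [c0] yields zeros [c0 16^m] at all scales. The
    factor [4^-m] becomes [16^-m] after squaring and is exactly offset by the number [16^m] of
    points of a block, so the relative errors left by truncation and by the width of the block have
    to be summable in [m], uniformly in [K]. Having about [16^m] points at scale [16^m] is also all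
    that the counting function and the Abel means see, which is why they do not detect the failure.

    The delicate estimate is the lower bound for the Gramian. The Toeplitz matrix has diagonal 1/2,
    but 4/17 and 16/257 each occur twice in an interior row and already add up to more than 1/2, so
    it is not diagonally dominant; the banded Gram matrix removes nearly all of the entries at
    distances 1 and 2. These bounds concern finite sections. For an infinite sequence the lower
    bound is recovered from a finite head observed over a finite horizon, the tail being controlled
    by the upper bound. *)

Section AbsoluteSummability.
Variable R : realType.
Implicit Types u v : nat -> R.

Definition abs_summable u : Prop :=
  exists B, forall n, \sum_(k < n) `|u k| <= B.

Definition rsum u : R := limn (series u).

Lemma series_ord u n : series u n = \sum_(k < n) u k.
Proof. by rewrite seriesEord. Qed.

Lemma abs_summable_cvg u : abs_summable u -> cvgn (series u).
Proof.
move=> [B hB]; apply: normed_cvg.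
apply: nondecreasing_is_cvgn.
  by apply: nondecreasing_series => n _ _ /=; exact: normr_ge0.
by exists B => _ [n _ <-]; have := hB n; rewrite -(series_ord (fun k => `|u k|)).
Qed.

Lemma abs_summableD a u v :
  abs_summable u -> abs_summable v -> abs_summable (fun k => a * u k + v k).
Proof.
move=> [B hB] [C hC]; exists (`|a| * B + C) => n.
apply: (@le_trans _ _ (\sum_(k < n) (`|a| * `|u k| + `|v k|))).
  by apply: ler_sum => k _; rewrite -normrM ler_normD.
by rewrite big_split /= -mulr_sumr; apply: lerD; [exact: ler_wpM2l (hB n)|exact: hC].
Qed.

Lemma abs_summable_le u v : (forall k, `|u k| <= v k) ->
  abs_summable v -> abs_summable u.
Proof.
move=> uv [B hB]; exists B => n; apply: le_trans (hB n).
by apply: ler_sum => k _; apply: le_trans (uv k) (ler_norm _).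
Qed.

Lemma abs_summable_ge0 u B : (forall k, 0 <= u k) ->
  (forall n, \sum_(k < n) u k <= B) -> abs_summable u.
Proof.
move=> u0 hB; exists B => n; apply: le_trans (hB n).
by apply: ler_sum => k _; rewrite ger0_norm.
Qed.

Lemma rsumD a u v : abs_summable u -> abs_summable v ->
  rsum (fun k => a * u k + v k) = a * rsum u + rsum v.
Proof.
move=> /abs_summable_cvg cu /abs_summable_cvg cv.
apply/cvg_lim => //.
have -> : series (fun k => a * u k + v k) = (a *: series u) + series v.
  apply/funext => n; rewrite /= series_ord big_split /= -mulr_sumr.
  by rewrite -!series_ord.
apply: cvgD; last exact: cv.
apply: cvgZr; exact: cu.
Qed.

Lemma rsum0 : rsum (fun=> 0) = 0.
Proof.
apply/cvg_lim => //.
rewrite (_ : series _ = cst 0); first exact: cvg_cst.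
by apply/funext => n; rewrite series_ord big1.
Qed.

Lemma abs_summable0 : abs_summable (fun=> 0).
Proof. by exists 0 => n; rewrite big1 // => i _; rewrite normr0. Qed.

Lemma rsumZ a u : abs_summable u -> rsum (fun k => a * u k) = a * rsum u.
Proof.
move=> su; have := rsumD a su abs_summable0; rewrite rsum0 addr0 => <-.
by congr rsum; apply/funext => k; rewrite addr0.
Qed.

Lemma partial_le_rsum u n : (forall k, 0 <= u k) -> abs_summable u ->
  \sum_(k < n) u k <= rsum u.
Proof.
move=> u0 /abs_summable_cvg cu; rewrite -series_ord.
apply: nondecreasing_cvgn_le cu _.
by apply: nondecreasing_series => k _ _; exact: u0.
Qed.

Lemma rsum_le u B : abs_summable u -> (forall n, \sum_(k < n) u k <= B) ->
  rsum u <= B.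
Proof.
move=> /abs_summable_cvg cu hB; apply: limr_le => //.
by apply: nearW => n; rewrite series_ord.
Qed.

Lemma ler_rsum u v : abs_summable u -> abs_summable v ->
  (forall k, u k <= v k) -> rsum u <= rsum v.
Proof.
move=> /abs_summable_cvg cu /abs_summable_cvg cv uv; apply: ler_lim => //.
by apply: nearW => n; rewrite !series_ord; apply: ler_sum => k _.
Qed.

Lemma rsum_finite K u : (forall k, (K <= k)%N -> u k = 0) ->
  abs_summable u /\ rsum u = \sum_(k < K) u k.
Proof.
move=> hu.
have sE (v : nat -> R) n : (forall k, (K <= k)%N -> v k = 0) -> (K <= n)%N ->
    \sum_(k < n) v k = \sum_(k < K) v k.
  move=> hv /subnKC <-; rewrite big_split_ord /= [X in _ + X]big1 ?addr0 //.
  by move=> i _; apply: hv; rewrite leq_addr.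
have hn k : (K <= k)%N -> `|u k| = 0 by move=> /hu ->; rewrite normr0.
split.
  exists (\sum_(k < K) `|u k|) => n.
  have [/(sE _ _ hn) -> //|/ltnW nK] := leqP K n.
  rewrite -(subnKC nK) big_split_ord /= lerDl; apply: sumr_ge0 => i _ //.
apply/cvg_lim => //; apply: cvg_near_cst.
near=> n; rewrite series_ord; apply: sE => //.
by near: n; exact: nbhs_infty_ge.
Unshelve. all: by end_near. Qed.

End AbsoluteSummability.

(** * The squared modulus and auxiliary limits *)

Section NormSquare.
Variable R : realType.
Implicit Types z w : R[i].

(** The squared modulus as an element of [R]: the norm of [R[i]] is itself [R[i]]-valued, whereas
    the series below are real. *)
Definition nsq z : R := complex.Re z ^+ 2 + complex.Im z ^+ 2.

Lemma nsq_ge0 z : 0 <= nsq z.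
Proof. by rewrite addr_ge0 // sqr_ge0. Qed.

Lemma nsqM z w : nsq (z * w) = nsq z * nsq w.
Proof. by case: z => a b; case: w => c d; rewrite /nsq /=; ring. Qed.

Lemma nsqD z w : nsq (z + w) <= 2 * nsq z + 2 * nsq w.
Proof.
case: z => a b; case: w => c d; rewrite /nsq /=.
have := sqr_ge0 (a - c); have := sqr_ge0 (b - d); lra.
Qed.

Lemma nsqE z : (nsq z)%:C%C = `|z| ^+ 2.
Proof. exact: add_Re2_Im2. Qed.

Lemma nsq0_eq0 z : nsq z = 0 -> z = 0.
Proof.
case: z => a b; rewrite /nsq /= => /eqP.
by rewrite paddr_eq0 ?sqr_ge0 // !sqrf_eq0 => /andP[/eqP -> /eqP ->].
Qed.

Lemma nsq0 : nsq 0 = 0.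
Proof. by rewrite /nsq /= expr0n /= addr0. Qed.

Lemma nsqN z : nsq (- z) = nsq z.
Proof. by case: z => a b; rewrite /nsq /= !sqrrN. Qed.

Lemma normr_Re_mul z w : `|complex.Re (z * w)| <= nsq z + nsq w.
Proof.
case: z => a b; case: w => c d; rewrite /nsq /= ler_norml.
have := sqr_ge0 (a - c); have := sqr_ge0 (b - d).
have := sqr_ge0 (a + c); have := sqr_ge0 (b + d).
have := sqr_ge0 a; have := sqr_ge0 b; have := sqr_ge0 c; have := sqr_ge0 d.
by move=> *; apply/andP; split; lra.
Qed.

Lemma normr_Im_mul z w : `|complex.Im (z * w)| <= nsq z + nsq w.
Proof.
case: z => a b; case: w => c d; rewrite /nsq /= ler_norml.
have := sqr_ge0 (a - d); have := sqr_ge0 (b - c).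
have := sqr_ge0 (a + d); have := sqr_ge0 (b + c).
have := sqr_ge0 a; have := sqr_ge0 b; have := sqr_ge0 c; have := sqr_ge0 d.
by move=> *; apply/andP; split; lra.
Qed.

Lemma nsq_conj z : nsq (z^*)%C = nsq z.
Proof. by case: z => a b; rewrite /nsq /= sqrrN. Qed.

End NormSquare.

Lemma cvg_sum_ord (R : realType) K (f : nat -> nat -> R) (l : nat -> R) :
  (forall k, f k @ \oo --> l k) ->
  (fun m => \sum_(k < K) f k m) @ \oo --> \sum_(k < K) l k.
Proof.
move=> fl; elim: K => [|K IH].
  by under eq_fun do rewrite big_ord0; rewrite big_ord0; exact: cvg_cst.
under eq_fun do rewrite big_ord_recr /=; rewrite big_ord_recr /=.
by apply: cvgD.
Qed.

Lemma exists_geometric4_lt (R : realType) (c e : R) : 0 < e ->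
  exists N : nat, c * 4%:R ^- N < e.
Proof.
move=> e0.
have /cvgrPdist_lt : (fun n => c * (4%:R^-1) ^+ n : R) @ \oo --> (0 : R).
  rewrite -[X in _ --> X](mulr0 c); apply: cvgZr; apply: cvg_expr.
  by rewrite ger0_norm ?invr_ge0 // invf_lt1 ?ltr1n // ltr0n.
move=> /(_ _ e0) [N _ /(_ N (leqnn N))] /=.
rewrite sub0r normrN exprVn => h; exists N; exact: le_lt_trans (ler_norm _) h.
Qed.

(** The hypothesis is the estimate that coordinates inherit from points chosen in balls of radius
    [2^-n] of a Cauchy filter. *)
Lemma geometric4_cauchy_cvg (R : realType) (v : nat -> R) :
  (forall m n, (v m - v n) ^+ 2 <= 2 * 4%:R ^- m + 2 * 4%:R ^- n) -> cvgn v.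
Proof.
move=> hv; apply/cauchy_cvgP/cauchyP => e e0.
have [N hN] := exists_geometric4_lt 4 (exprn_gt0 2 e0).
exists (v N), N => // n /= Nn; rewrite -ball_normE /=.
rewrite -ltr_sqr ?nnegrE ?(ltW e0) // real_normK ?num_real //.
apply: le_lt_trans (hv _ _) (le_lt_trans _ hN).
have : (4%:R ^- n : R) <= 4%:R ^- N.
  by rewrite lef_pV2 ?posrE ?exprn_gt0 // ler_eXn2l // ltr1n.
lra.
Qed.

(** * Square-summable sequences: inner product, norm and completeness *)

Section SquareSummable.
Variable R : realType.
Notation C := R[i].

Definition sq_summable : {pred (nat -> C)} :=
  fun x => `[< abs_summable (fun k => nsq (x k)) >].

Lemma sq_summableP (x : nat -> C) :
  reflect (abs_summable (fun k => nsq (x k))) (x \in sq_summable).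
Proof. exact: asboolP. Qed.

Lemma sq_summable_submod : submod_closed sq_summable.
Proof.
split.
  apply/sq_summableP; exists 0 => n; rewrite big1 // => i _.
  by rewrite nsq0 normr0.
move=> a x y /sq_summableP sx /sq_summableP sy; apply/sq_summableP.
have h := abs_summableD (nsq a) sx sy.
have := abs_summableD 1 h h.
apply: abs_summable_le => k /=.
rewrite ger0_norm ?nsq_ge0 //; apply: le_trans (nsqD _ _) _.
by rewrite nsqM mul1r; lra.
Qed.

HB.instance Definition _ := GRing.isSubmodClosed.Build C (nat -> C)
  sq_summable sq_summable_submod.

Record l2 := L2 { l2fun :> nat -> C; _ : l2fun \in sq_summable }.

HB.instance Definition _ := [isSub for l2fun].
HB.instance Definition _ := [Choice of l2 by <:].
HB.instance Definition _ := [SubChoice_isSubLmodule of l2 by <:].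

Lemma l2P (x : l2) : abs_summable (fun k => nsq (x k)).
Proof. by apply/sq_summableP; exact: (valP x). Qed.

Lemma l2_ext (x y : l2) : (forall k, x k = y k) -> x = y.
Proof. by move=> h; apply/val_inj/funext. Qed.

Lemma l2D (x y : l2) k : (x + y) k = x k + y k. Proof. by []. Qed.
Lemma l2N (x : l2) k : (- x) k = - x k. Proof. by []. Qed.
Lemma l2Z (a : C) (x : l2) k : (a *: x) k = a * x k. Proof. by []. Qed.
Lemma l20 k : (0 : l2) k = 0. Proof. by []. Qed.

Definition csum (u : nat -> C) : C :=
  Complex (rsum (fun k => complex.Re (u k))) (rsum (fun k => complex.Im (u k))).

Definition cabs_summable (u : nat -> C) : Prop :=
  abs_summable (fun k => complex.Re (u k)) /\
  abs_summable (fun k => complex.Im (u k)).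

Lemma csumD (a : C) u v : cabs_summable u -> cabs_summable v ->
  csum (fun k => a * u k + v k) = a * csum u + csum v.
Proof.
move=> [ru iu] [rv iv]; rewrite /csum; case: a => a b.
apply/eqP; rewrite eq_complex /=; apply/andP; split; apply/eqP.
  transitivity (a * rsum (fun k => complex.Re (u k)) +
      rsum (fun k => (- b) * complex.Im (u k) + complex.Re (v k))).
    rewrite -rsumD //; last exact: abs_summableD.
    by congr rsum; apply/funext => k; case: (u k) => ? ?; case: (v k) => ? ? /=; ring.
  by rewrite rsumD //; ring.
transitivity (a * rsum (fun k => complex.Im (u k)) +
      rsum (fun k => b * complex.Re (u k) + complex.Im (v k))).
  rewrite -rsumD //; last exact: abs_summableD.
  by congr rsum; apply/funext => k; case: (u k) => ? ?; case: (v k) => ? ? /=; ring.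
by rewrite rsumD //; ring.
Qed.

Definition l2dot (x y : l2) : C := csum (fun k => x k * (y k)^*%C).

Lemma l2_mul_summable (x y : l2) : cabs_summable (fun k => x k * (y k)^*%C).
Proof.
have h := abs_summableD 1 (l2P x) (l2P y).
split; apply: abs_summable_le h => k; rewrite mul1r -[X in _ <= _ + X]nsq_conj.
  exact: normr_Re_mul.
exact: normr_Im_mul.
Qed.

Lemma l2dot_linear (y : l2) : GRing.linear_for *%R (fun x => l2dot x y).
Proof.
move=> a u v /=; rewrite /l2dot -csumD; try exact: l2_mul_summable.
by congr csum; apply/funext => k; rewrite l2D l2Z mulrDl mulrA.
Qed.

Lemma rsumN u : abs_summable u -> rsum (fun k => - u k : R) = - rsum u.
Proof.
move=> su; rewrite -mulN1r -rsumZ //.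
by congr rsum; apply/funext => k; rewrite mulN1r.
Qed.

Lemma l2dotC (x y : l2) : l2dot x y = ((l2dot y x)^*)%C.
Proof.
have [_ h] := l2_mul_summable y x.
rewrite /l2dot /csum /= -rsumN //.
by congr Complex; congr rsum; apply/funext => k;
  case: (x k) => ? ?; case: (y k) => ? ? /=; ring.
Qed.

Lemma l2dot_herm (x y : l2) :
  l2dot x y = (-1) ^+ false * Num.conj (l2dot y x).
Proof. by rewrite expr0 mul1r l2dotC. Qed.

Lemma l2dot_bilinear : bilinear_for *%R (Num.conj \; *%R) l2dot.
Proof.
split; first exact: l2dot_linear.
move=> u a v w /=.
by rewrite l2dotC l2dot_linear rmorphD rmorphM /= (l2dotC u v) (l2dotC u w).
Qed.

HB.instance Definition _ := bilinear_isBilinear.Build C l2 l2 C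
  *%R (Num.conj \; *%R) l2dot l2dot_bilinear.

HB.instance Definition _ := isHermitianSesquilinear.Build C l2 false Num.conj
  l2dot l2dot_herm.

Definition l2nsq (x : l2) : R := rsum (fun k => nsq (x k)).

Lemma l2dotxx (x : l2) : l2dot x x = (l2nsq x)%:C%C.
Proof.
rewrite /l2dot /csum /l2nsq; congr Complex.
  by congr rsum; apply/funext => k; rewrite /nsq; case: (x k) => ? ? /=; ring.
rewrite -[RHS](@rsum0 R).
by congr rsum; apply/funext => k; case: (x k) => ? ? /=; ring.
Qed.

Lemma nsq_le_l2nsq (x : l2) k : nsq (x k) <= l2nsq x.
Proof.
have := @partial_le_rsum R _ k.+1 (fun k => nsq_ge0 (x k)) (l2P x).
apply: le_trans; rewrite big_ord_recr /= lerDr.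
by apply: sumr_ge0 => i _; exact: nsq_ge0.
Qed.

Lemma l2nsq_ge0 (x : l2) : 0 <= l2nsq x.
Proof. by apply: le_trans (nsq_le_l2nsq x 0); exact: nsq_ge0. Qed.

Lemma l2nsq_eq0 (x : l2) : l2nsq x = 0 -> x = 0.
Proof.
move=> x0; apply: l2_ext => k; apply: nsq0_eq0; apply/eqP.
by rewrite eq_le nsq_ge0 andbT -x0 nsq_le_l2nsq.
Qed.

Lemma l2dot_def (x : l2) : x != 0 -> 0 < l2dot x x.
Proof.
move=> x0; rewrite l2dotxx ltcR lt_def l2nsq_ge0 andbT.
by apply: contra x0 => /eqP /l2nsq_eq0 ->.
Qed.

HB.instance Definition _ := isDotProduct.Build C l2 l2dot l2dot_def.

Definition l2norm (x : l2) : C := (Num.sqrt (l2nsq x))%:C%C.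

Lemma l2norm_sqr (x : l2) : l2norm x ^+ 2 = l2dot x x.
Proof.
by rewrite /l2norm -[LHS](rmorphXn (real_complex R)) /= sqr_sqrtr ?l2nsq_ge0 // l2dotxx.
Qed.

(* The bound with weights [s] and [1/s], optimised at
   [s = sqrt (l2nsq y / l2nsq x)], is Minkowski's inequality. *)
Lemma l2nsqD_weighted (s : R) (x y : l2) : 0 < s ->
  l2nsq (x + y) <= (1 + s) * l2nsq x + (1 + s^-1) * l2nsq y.
Proof.
move=> s0; rewrite /l2nsq -[X in _ <= _ + X]rsumZ; last exact: l2P.
have sy : abs_summable (fun k => (1 + s^-1) * nsq (y k)).
  have := abs_summableD (1 + s^-1) (l2P y) (@abs_summable0 R).
  by congr abs_summable; apply/funext => k; rewrite addr0.
rewrite -(rsumD (1 + s)) //; last exact: l2P.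
apply: ler_rsum; [exact: l2P|exact: abs_summableD (l2P x) sy|].
move=> k; rewrite l2D; case: (x k) => a b; case: (y k) => c d; rewrite /nsq /=.
have h (p q : R) : (p + q) ^+ 2 <= (1 + s) * p ^+ 2 + (1 + s^-1) * q ^+ 2.
  have -> : (1 + s) * p ^+ 2 + (1 + s^-1) * q ^+ 2 =
      (p + q) ^+ 2 + s * (p - q / s) ^+ 2 by field; rewrite gt_eqF.
  by rewrite lerDl mulr_ge0 ?sqr_ge0 // ltW.
have := h a c; have := h b d; lra.
Qed.

Lemma l2nsqZ (a : C) (x : l2) : l2nsq (a *: x) = nsq a * l2nsq x.
Proof.
rewrite /l2nsq -rsumZ; last exact: l2P.
by congr rsum; apply/funext => k; rewrite l2Z nsqM.
Qed.

Lemma l2nsqN (x : l2) : l2nsq (- x) = l2nsq x.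
Proof. by rewrite /l2nsq; congr rsum; apply/funext => k; rewrite l2N nsqN. Qed.

(** The weight [s = 1] in the weighted bound gives a triangle inequality free of square roots. *)
Lemma l2nsq_dist (x y z : l2) :
  l2nsq (x - y) <= 2 * l2nsq (x - z) + 2 * l2nsq (y - z).
Proof.
have := l2nsqD_weighted (x - z) (- (y - z)) ltr01.
by rewrite opprB addrA subrK invr1 -opprB l2nsqN.
Qed.

Lemma l2norm_triangle (x y : l2) : l2norm (x + y) <= l2norm x + l2norm y.
Proof.
rewrite /l2norm -[leRHS](rmorphD (real_complex R)) lecR.
have [/l2nsq_eq0 ->|x0] := eqVneq (l2nsq x) 0.
  by rewrite add0r lerDr sqrtr_ge0.
have [/l2nsq_eq0 ->|y0] := eqVneq (l2nsq y) 0.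
  by rewrite addr0 lerDl sqrtr_ge0.
set a := Num.sqrt (l2nsq x); set b := Num.sqrt (l2nsq y).
have a0 : 0 < a by rewrite sqrtr_gt0 lt_def x0 l2nsq_ge0.
have b0 : 0 < b by rewrite sqrtr_gt0 lt_def y0 l2nsq_ge0.
have ax : l2nsq x = a ^+ 2 by rewrite sqr_sqrtr // l2nsq_ge0.
have bx : l2nsq y = b ^+ 2 by rewrite sqr_sqrtr // l2nsq_ge0.
have -> : a + b = Num.sqrt ((a + b) ^+ 2).
  by rewrite sqrtr_sqr ger0_norm // addr_ge0 // ltW.
apply: ler_wsqrtr.
have := l2nsqD_weighted x y (divr_gt0 b0 a0).
rewrite ax bx; congr (_ <= _); field.
by rewrite !gt_eqF.
Qed.

Lemma l2normZ (a : C) (x : l2) : l2norm (a *: x) = `|a| * l2norm x.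
Proof.
have -> : `|a| = (Num.sqrt (nsq a))%:C%C by rewrite normc_def.
rewrite /l2norm -[RHS](rmorphM (real_complex R)) /= -sqrtrM ?nsq_ge0 //.
by rewrite l2nsqZ.
Qed.

Lemma l2norm0_eq0 (x : l2) : l2norm x = 0 -> x = 0.
Proof.
move=> /complexI /eqP; rewrite sqrtr_eq0 => h; apply: l2nsq_eq0.
by apply/eqP; rewrite eq_le h l2nsq_ge0.
Qed.

HB.instance Definition _ := Lmodule_isNormed.Build C l2
  l2norm_triangle l2normZ l2norm0_eq0.

Lemma l2_normE (x : l2) : `|x| = (Num.sqrt (l2nsq x))%:C%C.
Proof. by []. Qed.

Lemma l2_ballE (x : l2) (e : R) (y : l2) : 0 < e ->
  ball x e%:C%C y <-> l2nsq (x - y) < e ^+ 2.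
Proof.
move=> e0; rewrite -ball_normE /= l2_normE ltcR -{1}[e]ger0_norm ?ltW //.
by rewrite -sqrtr_sqr ltr_sqrt // exprn_gt0.
Qed.

Lemma pos_complexP (e : C) : 0 < e -> exists2 r : R, 0 < r & e = r%:C%C.
Proof.
case: e => r i; rewrite ltcE /= => /andP[/eqP -> r0]; by exists r.
Qed.

(** Points [u n] whose balls of radius [2^-n] belong to the filter form a fast Cauchy sequence. Its
    coordinatewise limit is also the limit in norm: the Cauchy estimate passes to the limit in every
    finite partial sum. *)
Lemma l2_complete (F : set_system l2) : ProperFilter F -> cauchy F -> cvg F.
Proof.
move=> FF /cauchyP cF.
have {cF} /choice [u hu] : forall n : nat, exists x : l2,
    F [set y | l2nsq (x - y) < 4%:R ^- n].
  move=> n; have e0 : 0 < (2%:R ^- n : R) by rewrite invr_gt0 exprn_gt0.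
  have [] := cF ((2%:R ^- n : R)%:C%C); first by rewrite ltcR.
  move=> x Fx; exists x; apply: filterS Fx => y /l2_ballE => /(_ e0).
  by rewrite /= exprVn -exprM mulnC exprM -natrX.
have huu m n : l2nsq (u m - u n) <= 2 * 4%:R ^- m + 2 * 4%:R ^- n.
  have FI : F ([set y | l2nsq (u m - y) < 4%:R ^- m] `&`
      [set y | l2nsq (u n - y) < 4%:R ^- n]).
    by apply: filterI; [exact: hu|exact: hu].
  have [y [/= ym yn]] := filter_ex FI.
  apply: le_trans (l2nsq_dist _ _ y) _.
  by apply: lerD; rewrite ler_pM2l ?ltr0n // ltW.
have uk2 k m n : nsq (u m k - u n k) <= 2 * 4%:R ^- m + 2 * 4%:R ^- n.
  by apply: le_trans (huu m n); exact: nsq_le_l2nsq (u m - u n) k.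
have cre k : cvgn (fun n => complex.Re (u n k)).
  apply: geometric4_cauchy_cvg => m n; apply: le_trans (uk2 k m n).
  by rewrite /nsq; case: (u m k) => ? ?; case: (u n k) => ? ? /=; rewrite lerDl sqr_ge0.
have cim k : cvgn (fun n => complex.Im (u n k)).
  apply: geometric4_cauchy_cvg => m n; apply: le_trans (uk2 k m n).
  by rewrite /nsq; case: (u m k) => ? ?; case: (u n k) => ? ? /=; rewrite lerDr sqr_ge0.
pose y0 k : C := Complex (limn (fun n => complex.Re (u n k)))
                         (limn (fun n => complex.Im (u n k))).
have hy n K : \sum_(k < K) nsq (u n k - y0 k) <= 4 * 4%:R ^- n.
  have cv : (fun m => \sum_(k < K) nsq (u n k - u m k)) @ \oo -->
      \sum_(k < K) nsq (u n k - y0 k).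
    apply: (@cvg_sum_ord R K (fun k m => nsq (u n k - u m k))
      (fun k => nsq (u n k - y0 k))) => k; apply: cvgD.
      under eq_fun do rewrite raddfB.
      by rewrite raddfB; apply: cvgM; apply: cvgB;
        [exact: cvg_cst|exact: cre|exact: cvg_cst|exact: cre].
    under eq_fun do rewrite raddfB.
    by rewrite raddfB; apply: cvgM; apply: cvgB;
      [exact: cvg_cst|exact: cim|exact: cvg_cst|exact: cim].
  rewrite -(cvg_lim _ cv) //; apply: limr_le; first by apply: cvgP cv.
  exists n => // m /= nm.
  apply: (@le_trans _ _ (l2nsq (u n - u m))).
    exact: (@partial_le_rsum R _ K (fun k => nsq_ge0 _) (l2P (u n - u m))).
  apply: le_trans (huu n m) _.
  have : (4%:R ^- m : R) <= 4%:R ^- n.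
    by rewrite lef_pV2 ?posrE ?exprn_gt0 // ler_eXn2l // ltr1n.
  lra.
(* Square summability of the limit comes from its difference with [u 0], which the bound [hy]
   controls; the limit is then recovered by subtraction. *)
have sz : (fun k => u 0%N k - y0 k) \in sq_summable.
  by apply/sq_summableP; apply: abs_summable_ge0 (hy 0%N) => k; exact: nsq_ge0.
pose y := u 0%N - L2 sz.
have yE k : y k = y0 k by rewrite l2D l2N /= opprB addrC subrK.
have huy n : l2nsq (u n - y) <= 4 * 4%:R ^- n.
  apply: rsum_le; first exact: l2P.
  move=> K; apply: le_trans (hy n K).
  by rewrite le_eqVlt; apply/orP; left; apply/eqP; apply: eq_bigr => k _; rewrite l2D l2N yE.
apply/cvg_ex; exists y; apply/cvg_ballP => e /pos_complexP [r r0 ->].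
(* Here [10 = 2 * 1 + 2 * 4], from the squared distances of [u n] to [z] and to [y]. *)
have [n hn] := exists_geometric4_lt 10 (exprn_gt0 2 r0).
apply: filterS (hu n) => z /= zn; apply/l2_ballE => //.
have -> : l2nsq (y - z) = l2nsq (z - y) by rewrite -l2nsqN opprB.
apply: le_lt_trans (l2nsq_dist _ _ (u n)) (le_lt_trans _ hn).
have -> : l2nsq (z - u n) = l2nsq (u n - z) by rewrite -l2nsqN opprB.
have -> : l2nsq (y - u n) = l2nsq (u n - y) by rewrite -l2nsqN opprB.
have := huy n; move: (ltW zn).
move: (l2nsq _) (l2nsq _) (_ ^- n) => a b c; lra.
Qed.

HB.instance Definition _ := Uniform_isComplete.Build l2 l2_complete.

Definition l2_hilbert : hilbertSpace R :=
  @HilbertSpace R l2 l2dot (fun x => esym (l2norm_sqr x)).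

End SquareSummable.

(** * Functional calculus of diagonal operators *)

Section DiagonalOperators.
Variable R : realType.
Notation C := R[i].
Notation l2 := (l2 R).

(* Junk value: [0] when [u] is not square summable. *)
Definition l2_of (u : nat -> C) : l2 := insubd 0 u.

Lemma l2_ofE (u : nat -> C) k : abs_summable (fun k => nsq (u k)) ->
  l2_of u k = u k.
Proof. by move=> /sq_summableP su; rewrite /l2_of /insubd insubT. Qed.

Definition l2_fin K (u : nat -> C) : l2 :=
  l2_of (fun k => if (k < K)%N then u k else 0).

Lemma l2_finE K u k : l2_fin K u k = if (k < K)%N then u k else 0.
Proof.
rewrite /l2_fin l2_ofE //.
have [] // := @rsum_finite R K (fun k => nsq (if (k < K)%N then u k else 0)).
by move=> j; rewrite ltnNge => ->; rewrite nsq0.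
Qed.

Lemma l2nsq_fin K u : l2nsq (l2_fin K u) = \sum_(k < K) nsq (u k).
Proof.
rewrite /l2nsq (rsum_finite (K := K) _).2.
  by apply: eq_bigr => k _; rewrite l2_finE ltn_ord.
by move=> k; rewrite leqNgt l2_finE => /negbTE ->; rewrite nsq0.
Qed.

Lemma linearB_of (f : l2 -> l2) (lf : linear f) x y : f (x - y) = f x - f y.
Proof.
have := lf (-1) y x.
by rewrite !scaleN1r (addrC (- y)) (addrC (- f y)).
Qed.

Lemma l2_linear_continuous (f : l2 -> l2) (M : R) : linear f ->
  (forall x, l2nsq (f x) <= M * l2nsq x) -> continuous f.
Proof.
move=> lf fM x; apply/(@cvgrPdist_lt _ _ _ (nbhs x)) => e /pos_complexP [r r0 ->].
(* Since [N >= 1], one has [M <= N <= N ^+ 2], so [N] is a Lipschitz constant obtained without a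
   square root. *)
pose N := `|M| + 1.
have N1 : 1 <= N by rewrite /N lerDr.
have N0 : 0 < N by apply: lt_le_trans N1.
have d0 : 0 < r / N by rewrite divr_gt0.
near=> z; apply/l2_ballE => //.
rewrite -(linearB_of lf).
apply: le_lt_trans (fM _) _.
have : l2nsq (x - z) < (r / N) ^+ 2.
  apply/l2_ballE => //; near: z.
  by apply: nbhsx_ballx; rewrite ltcR.
rewrite expr_div_n ltr_pdivlMr ?exprn_gt0 // => h.
apply: le_lt_trans h; rewrite mulrC.
apply: ler_wpM2l; first exact: l2nsq_ge0.
apply: (@le_trans _ _ N); first by rewrite /N (le_trans (ler_norm _)) // lerDl.
by rewrite expr2 ler_peMr // ltW.
Unshelve. all: by end_near. Qed.

Definition diag (d : nat -> C) (x : l2) : l2 := l2_of (fun k => d k * x k).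

Definition bounded_coef (d : nat -> C) := exists M : R, forall k, nsq (d k) <= M.

Lemma diag_summable d (x : l2) : bounded_coef d ->
  abs_summable (fun k => nsq (d k * x k)).
Proof.
move=> [M dM]; have := abs_summableD M (l2P x) (@abs_summable0 R).
apply: abs_summable_le => k.
by rewrite addr0 ger0_norm ?nsq_ge0 // nsqM ler_wpM2r ?nsq_ge0.
Qed.

Lemma diagE d x k : bounded_coef d -> diag d x k = d k * x k.
Proof. by move=> bd; rewrite /diag l2_ofE //; exact: diag_summable. Qed.

Lemma l2nsq_diag d M x : (forall k, nsq (d k) <= M) ->
  l2nsq (diag d x) <= M * l2nsq x.
Proof.
move=> dM; have bd : bounded_coef d by exists M.
rewrite /l2nsq -rsumZ; last exact: l2P.
apply: ler_rsum; [exact: l2P| |].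
  have := abs_summableD M (l2P x) (@abs_summable0 R).
  by congr abs_summable; apply/funext => k; rewrite addr0.
by move=> k; rewrite diagE // nsqM ler_wpM2r ?nsq_ge0.
Qed.

Lemma diag_bounded_op d : bounded_coef d ->
  @bounded_op R (l2 : normedModType C) (l2 : normedModType C) (diag d).
Proof.
move=> bd; have ld : linear (diag d).
  move=> a x y; apply: l2_ext => k.
  by rewrite l2D l2Z !diagE // l2D l2Z mulrDr mulrCA.
split => //; case: (bd) => M dM.
by apply: (l2_linear_continuous ld) => x; exact: l2nsq_diag.
Qed.

Variable lam : nat -> R.
Hypothesis lam01 : forall k, 0 <= lam k <= 1.
Hypothesis lam1 : lam @ \oo --> (1 : R).

Let dlam k : C := (lam k)%:C%C.

Definition diag_calculus (f : C -> C) : l2 -> l2 := diag (fun k => f (dlam k)).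

Let A : l2 -> l2 := diag dlam.

Lemma bounded_dlam : bounded_coef dlam.
Proof.
exists 1 => k; rewrite /nsq /= expr0n addr0 expr_le1 //; first by case/andP: (lam01 k).
by case/andP: (lam01 k).
Qed.

Definition l2_unit k : l2 := l2_fin k.+1 (fun j => (j == k)%:R).

Lemma l2_unitE k j : l2_unit k j = (j == k)%:R.
Proof.
rewrite l2_finE ltnS; have [//|kj] := leqP j k.
by rewrite gtn_eqF.
Qed.

Lemma l2nsq_unit k : l2nsq (l2_unit k) = 1.
Proof.
rewrite l2nsq_fin (bigD1 ord_max) //= eqxx big1 ?addr0.
  by rewrite /nsq /= expr1n expr0n addr0.
by move=> i; rewrite -val_eqE /= => /negbTE ->; rewrite nsq0.
Qed.

Lemma diag_eigen k : A (l2_unit k) = dlam k *: l2_unit k.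
Proof.
apply: l2_ext => j; rewrite diagE; last exact: bounded_dlam.
by rewrite l2Z l2_unitE; have [->//|_] := eqVneq j k; rewrite !mulr0.
Qed.

Lemma l2_unit_neq0 k : l2_unit k <> 0.
Proof.
move=> e0; have := l2nsq_unit k; rewrite e0.
rewrite /l2nsq -[X in X = _]/(rsum _).
under eq_fun do rewrite l20 nsq0.
by rewrite rsum0 => /eqP; rewrite eq_sym oner_eq0.
Qed.

Lemma linear0_of (f : l2 -> l2) : linear f -> f 0 = 0.
Proof. by move=> lf; have := lf (-1) 0 0; rewrite scaler0 addr0 scaleN1r addNr. Qed.

Lemma eigenvalue_spectrum k : spectrum (A : (l2 : normedModType C) -> _) (dlam k).
Proof.
move=> [B [[lB _] BA _]]; apply: (@l2_unit_neq0 k).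
by rewrite -(BA (l2_unit k)) diag_eigen subrr linear0_of.
Qed.

(** The value 1 need not be an eigenvalue, but the unit vectors are approximate eigenvectors:
    [(A - 1) e_k] tends to 0, while a continuous inverse would send it back to [e_k], of norm 1. *)
Lemma spectrum1 : spectrum (A : (l2 : normedModType C) -> _) 1.
Proof.
move=> [B [[lB cB] BA _]].
have e0 : (fun k => (dlam k - 1) *: l2_unit k) @ \oo --> (0 : l2).
  apply/cvg_ballP => e /pos_complexP [r r0 ->].
  move/cvgrPdist_lt : lam1 => /(_ _ r0) [N _ hN].
  exists N => // k /= Nk; apply/l2_ballE => //.
  have -> : l2nsq (0 - (dlam k - 1) *: l2_unit k) = (1 - lam k) ^+ 2.
    rewrite sub0r -scaleNr; have := l2nsqZ (- (dlam k - 1)) (l2_unit k).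
    rewrite l2nsq_unit mulr1 => ->; rewrite /dlam /nsq /=; ring.
  by rewrite -(@real_normK _ (1 - lam k)) ?num_real // ltr_sqr ?nnegrE ?(ltW r0) //; exact: hN.
have : (fun k => B ((dlam k - 1) *: l2_unit k)) @ \oo --> B (0 : l2).
  exact: (cvg_comp _ _ e0 (cB 0)).
rewrite linear0_of // => /cvg_ballP /(_ 1 ltr01) [N _ /(_ N (leqnn N))] /=.
have -> : (dlam N - 1) *: l2_unit N = A (l2_unit N) - 1 *: l2_unit N.
  by rewrite diag_eigen scalerBl.
rewrite BA => /(@l2_ballE _ _ 1) => /(_ ltr01).
rewrite sub0r (_ : l2nsq (- _) = 1) ?expr1n ?ltxx //.
rewrite -(l2nsq_unit N) /l2nsq; congr rsum.
by apply/funext => j; rewrite l2N nsqN.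
Qed.

(** Compactness of the spectrum is bypassed: the eigenvalues tend to 1, which lies in the spectrum,
    so by continuity there the values of [f] along the eigenvalues converge to [f 1]. *)
Lemma bounded_calculus f :
  continuous_on_spectrum (A : (l2 : normedModType C) -> _) f ->
  bounded_coef (fun k => f (dlam k)).
Proof.
move=> cf.
have : (fun k => f (dlam k) : C^o) @ \oo --> (f 1 : C^o).
  have cf1 := (subspace_continuousP _ _).1 cf 1 spectrum1.
  apply: cvg_comp cf1; rewrite /within => P /= [e /= e0 he].
  case: (pos_complexP e0) => r r0 er.
  move/cvgrPdist_lt : lam1 => /(_ _ r0) [N _ hN].
  exists N => // k /= Nk; apply: he; last exact: eigenvalue_spectrum.
  rewrite /= er; have := hN k Nk; rewrite /= -ltcR.
  apply: le_lt_trans; rewrite le_eqVlt; apply/orP; left; apply/eqP.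
  rewrite normc_def /dlam /=; congr (_%:C)%C.
  by rewrite subr0 expr0n /= addr0 sqrtr_sqr.
move=> /(@cvgrPdist_lt _ C^o) /(_ 1 ltr01) [N _ hN].
exists (\sum_(k < N) nsq (f (dlam k)) + 2 * (nsq (f 1) + 1)) => k.
have s0 : 0 <= \sum_(k < N) nsq (f (dlam k)) by apply: sumr_ge0 => i _; exact: nsq_ge0.
have := nsq_ge0 (f 1).
have [Nk|kN] := leqP N k.
  have := hN k Nk; rewrite /= => h1.
  have h2 : nsq (f 1 - f (dlam k)) <= 1.
    rewrite -lecR nsqE expr_le1 //; exact: ltW.
  have := nsqD (f 1) (- (f 1 - f (dlam k))).
  rewrite opprB addrC subrK -(nsqN (f (dlam k) - f 1)) opprB; lra.
rewrite (bigD1 (Ordinal kN)) //= in s0 *.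
have : 0 <= \sum_(i < N | i != Ordinal kN) nsq (f (dlam i)).
  by apply: sumr_ge0 => i _; exact: nsq_ge0.
lra.
Qed.

(** The spectrum need not be determined: the norm estimate uses only that it contains every
    eigenvalue, and boundedness of the values comes from [bounded_calculus]. *)
Lemma diag_calculusP : is_cfc (H := l2_hilbert R) A diag_calculus.
Proof.
split.
- by move=> f /bounded_calculus /diag_bounded_op.
- move=> x; apply: l2_ext => k; rewrite diagE ?mul1r //.
  by exists 1 => j; rewrite /nsq /= expr1n expr0n addr0.
- by [].
- move=> a f /bounded_calculus bf x; apply: l2_ext => k.
  rewrite l2Z !diagE ?mulrA //; case: bf => M hM; exists (nsq a * M) => j.
  by rewrite nsqM ler_wpM2l ?nsq_ge0.
- move=> f g /bounded_calculus bf /bounded_calculus bg x; apply: l2_ext => k.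
  rewrite l2D !diagE ?mulrDl //.
  case: bf bg => M hM [N hN]; exists (2 * M + 2 * N) => j.
  by apply: le_trans (nsqD _ _) _; have := hM j; have := hN j; lra.
- move=> f g /bounded_calculus bf /bounded_calculus bg x; apply: l2_ext => k.
  rewrite !diagE ?mulrA //.
  case: bf bg => M hM [N hN]; exists (M * N) => j.
  by rewrite nsqM ler_pM ?nsq_ge0.
- move=> f /bounded_calculus bf x y /=.
  have bfc : bounded_coef (fun k => (f (dlam k))^*).
    by case: bf => M hM; exists M => j; rewrite nsq_conj.
  rewrite /l2dot; congr csum; apply/funext => k.
  rewrite !diagE // rmorphM /= conjcK; ring.
- move=> f g M /bounded_calculus bf /bounded_calculus bg fg x.
  (* The spectrum is nonempty, which forces the bound to be nonnegative. *)
  have M0 : 0 <= M.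
    by rewrite -lecR; exact: le_trans (normr_ge0 _) (fg _ (@eigenvalue_spectrum 0%N)).
  have -> : diag_calculus f x - diag_calculus g x =
      diag (fun k => f (dlam k) - g (dlam k)) x.
    apply: l2_ext => k; rewrite l2D l2N !diagE ?mulrBl //.
    case: bf bg => M' hM [N hN]; exists (2 * M' + 2 * N) => j.
    by apply: le_trans (nsqD _ _) _; rewrite nsqN; have := hM j; have := hN j; lra.
  rewrite !l2_normE -[leRHS](rmorphM (real_complex R)) lecR.
  rewrite -[in leRHS](ger0_norm M0) -sqrtr_sqr -sqrtrM ?sqr_ge0 // ler_wsqrtr //.
  apply: l2nsq_diag => k; have fgk := fg _ (@eigenvalue_spectrum k).
  rewrite -lecR nsqE rmorphXn /= ler_sqr ?nnegrE ?ler0c //.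
  by rewrite -ler0c; exact: (normr_ge0 (f (dlam k) - g (dlam k))).
Qed.

Lemma diag_positive : positive_op (H := l2_hilbert R) A.
Proof.
split; first exact/diag_bounded_op/bounded_dlam.
move=> x /=; rewrite /l2dot /csum.
have -> : (fun k => complex.Im (A x k * (x k)^*%C)) = fun=> 0.
  apply/funext => k; rewrite diagE; last exact: bounded_dlam.
  by rewrite /dlam; case: (x k) => a b /=; ring.
rewrite rsum0 ler0c; apply: le_trans (_ : rsum (fun=> 0) <= _); first by rewrite rsum0.
apply: ler_rsum; [exact: abs_summable0|by have [] := l2_mul_summable (A x) x|].
move=> k; rewrite diagE; last exact: bounded_dlam.
rewrite /dlam; case: (x k) => a b /=.
have /andP[l0 _] := lam01 k.
have -> : (lam k * a - 0 * b) * a - (lam k * b + 0 * a) * - b =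
    lam k * (a ^+ 2 + b ^+ 2) by ring.
by rewrite mulr_ge0 // addr_ge0 ?sqr_ge0.
Qed.

End DiagonalOperators.

(** * The observability Gramian over the natural numbers *)

Section GramForm.
Variable R : realType.
Implicit Types (a : nat -> R) (k l n K N : nat).

Definition dist k l : nat := (k - l) + (l - k).

Lemma geometric_sum_le (z : R) n : 0 <= z < 1 ->
  \sum_(d < n) z ^+ d <= (1 - z)^-1.
Proof.
move=> /andP[z0 z1]; have h : 0 < 1 - z by rewrite subr_gt0.
rewrite -[leRHS]mul1r ler_pdivlMr //.
have -> : (\sum_(d < n) z ^+ d) * (1 - z) = 1 - z ^+ n.
  elim: n => [|n IH]; first by rewrite big_ord0 mul0r expr0 subrr.
  by rewrite big_ord_recr /= mulrDl IH exprS; ring.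
by rewrite gerBl exprn_ge0.
Qed.

(** Each distance occurs at most once on either side of [k], so each half of the row is bounded by a
    partial sum of [f]; on the right [f 0] is added in front to complete it. *)
Lemma sum_dist_le (f : nat -> R) B K k : (forall d, 0 <= f d) ->
  (forall n, \sum_(d < n) f d <= B) -> (k < K)%N ->
  \sum_(l < K) f (dist k l) <= B + B.
Proof.
move=> f0 fB kK; rewrite -(subnKC kK) big_split_ord /=; apply: lerD.
  rewrite (reindex_inj rev_ord_inj) /=; apply: le_trans (fB k.+1).
  apply: ler_sum => i _; rewrite le_eqVlt; apply/orP; left; apply/eqP.
  by congr f; rewrite /dist; have := ltn_ord i; lia.
apply: le_trans (fB (K - k.+1).+1); rewrite big_ord_recl -[leLHS]add0r.
apply: lerD => //; apply: ler_sum => i _.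
rewrite le_eqVlt; apply/orP; left; apply/eqP.
by congr f; rewrite /dist /= /bump /=; lia.
Qed.

Lemma geometric4_sum_le n : \sum_(d < n) (4^-1 : R) ^+ d <= 4 / 3.
Proof.
apply: le_trans (geometric_sum_le n _) _; first by apply/andP; split; lra.
by rewrite le_eqVlt; apply/orP; left; apply/eqP; field.
Qed.

(** Schur's test through [|a k * a l| <= (a k ^+ 2 + a l ^+ 2) / 2]; by symmetry of [e] the two
    halves have the same bound. *)
Lemma schur_test (E e : nat -> nat -> R) (rho : R) K a :
  (forall k l, `|E k l| <= e k l) -> (forall k l, e k l = e l k) ->
  (forall k, (k < K)%N -> \sum_(l < K) e k l <= rho) ->
  `|\sum_(k < K) \sum_(l < K) E k l * (a k * a l)| <=
     rho * \sum_(k < K) a k ^+ 2.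
Proof.
move=> Ee esym row.
have half : \sum_(k < K) \sum_(l < K) e k l * a k ^+ 2 <=
    rho * \sum_(k < K) a k ^+ 2.
  rewrite mulr_sumr; apply: ler_sum => k _.
  by rewrite -mulr_suml ler_wpM2r ?sqr_ge0 // row.
have half' : \sum_(k < K) \sum_(l < K) e k l * a l ^+ 2 <=
    rho * \sum_(k < K) a k ^+ 2.
  rewrite exchange_big /=; apply: le_trans half; apply: ler_sum => k _.
  by apply: ler_sum => l _; rewrite esym.
have : `|\sum_(k < K) \sum_(l < K) E k l * (a k * a l)| <=
    2^-1 * (\sum_(k < K) \sum_(l < K) e k l * a k ^+ 2 +
            \sum_(k < K) \sum_(l < K) e k l * a l ^+ 2).
  rewrite -big_split /= mulr_sumr.
  apply: le_trans (ler_norm_sum _ _ _) _; apply: ler_sum => k _.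
  rewrite -big_split /= mulr_sumr.
  apply: le_trans (ler_norm_sum _ _ _) _; apply: ler_sum => l _.
  rewrite normrM -mulrDr mulrCA.
  apply: ler_pM => //.
  rewrite normrM -[a k ^+ 2]real_normK ?num_real // -[a l ^+ 2]real_normK ?num_real //.
  have := sqr_ge0 (`|a k| - `|a l|); move: (`|a k|) (`|a l|) => x y; lra.
lra.
Qed.

Definition weight k : R := 4^-1 ^+ k.+1.
Definition decay k : R := 16^-1 ^+ k.+1.
Definition eigenvalue k : R := expR (- decay k).

Definition gram k l : R :=
  weight k * weight l / (1 - eigenvalue k * eigenvalue l).

Definition gram_form K a : R :=
  \sum_(k < K) \sum_(l < K) gram k l * (a k * a l).

Lemma weight_gt0 k : 0 < weight k.
Proof. by rewrite exprn_gt0 // invr_gt0. Qed.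

Lemma decay_gt0 k : 0 < decay k.
Proof. by rewrite exprn_gt0 // invr_gt0. Qed.

Lemma eigenvalue_lt1 k : 0 < eigenvalue k < 1.
Proof. by rewrite expR_gt0 /= expR_lt1 oppr_lt0 decay_gt0. Qed.

Lemma eigenvalueM_lt1 k l : eigenvalue k * eigenvalue l < 1.
Proof.
have /andP[k0 k1] := eigenvalue_lt1 k; have /andP[l0 l1] := eigenvalue_lt1 l.
rewrite -[ltRHS]mulr1; apply: ltr_pM => //; exact: ltW.
Qed.

(** The discrete Lyapunov equation [G = c c^T + D G D], with [D] the diagonal matrix of the
    eigenvalues: entrywise, [1 / (1 - z) = 1 + z / (1 - z)]. *)
Lemma gram_form_step K a : gram_form K a =
  (\sum_(k < K) weight k * a k) ^+ 2 +
  gram_form K (fun k => eigenvalue k * a k).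
Proof.
rewrite /gram_form expr2 mulr_suml -big_split; apply: eq_bigr => k _ /=.
rewrite mulr_sumr -big_split; apply: eq_bigr => l _ /=.
have : 1 - eigenvalue k * eigenvalue l != 0.
  by rewrite gt_eqF // subr_gt0 eigenvalueM_lt1.
rewrite /gram => h; field; exact: h.
Qed.

(** Iterating the Lyapunov equation gives the energy observed at times below [N]; the subtracted
    form is what remains unobserved. *)
Lemma gram_form_telescope K a N :
  \sum_(n < N) (\sum_(k < K) weight k * (eigenvalue k ^+ n * a k)) ^+ 2 =
  gram_form K a - gram_form K (fun k => eigenvalue k ^+ N * a k).
Proof.
elim: N => [|N IH].
  rewrite big_ord0 (_ : (fun k => _) = a) ?subrr //.
  by apply/funext => k; rewrite expr0 mul1r.
rewrite big_ord_recr /= IH [in LHS](gram_form_step K (fun k => _ ^+ N * _)).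
rewrite (_ : (fun k => eigenvalue k * _) = (fun k => eigenvalue k ^+ N.+1 * a k)).
  ring.
by apply/funext => k; rewrite exprS mulrA.
Qed.

(** The Toeplitz entry [1 / (4^d + 4^-d)], written so that the bound by [4^-d] is visible. *)
Definition cauchy_coef d : R := 4^-1 ^+ d / (1 + 16^-1 ^+ d).

Lemma weight_sqr k : weight k ^+ 2 = decay k.
Proof.
by rewrite /weight /decay -exprM mulnC exprM; congr (_ ^+ _); field.
Qed.

(** A Cauchy matrix scaled by the square roots of its nodes depends only on the ratios of the nodes;
    here the nodes are geometric, so it is Toeplitz. *)
Lemma sum_decay k l :
  weight k * weight l / (decay k + decay l) = cauchy_coef (dist k l).
Proof.
wlog kl : k l / (k <= l)%N => [h|].
  have /orP[/h //|/h] := leq_total k l.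
  rewrite (mulrC (weight k)) (addrC (decay k)) => ->.
  by congr cauchy_coef; rewrite /dist addnC.
have -> : dist k l = (l - k)%N by rewrite /dist; lia.
have -> : weight l = weight k * 4^-1 ^+ (l - k).
  by rewrite /weight -exprD; congr (_ ^+ _); lia.
have -> : decay l = decay k * 16^-1 ^+ (l - k).
  by rewrite /decay -exprD; congr (_ ^+ _); lia.
have d0 := decay_gt0 k; rewrite mulrA -expr2 weight_sqr /cauchy_coef.
have z0 : (16^-1 : R) ^+ (l - k) > 0 by rewrite exprn_gt0 // invr_gt0.
move: (decay k) d0 (16^-1 ^+ _) z0 (4^-1 ^+ _) => x x0 y y0 z.
have xy : x + x * y != 0 by rewrite gt_eqF // addr_gt0 // mulr_gt0.
have y1 : 1 + y != 0 by rewrite gt_eqF // addr_gt0.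
field; rewrite y1 /=; apply: contra xy => /eqP h; rewrite -h; apply/eqP; ring.
Qed.

(** With [u = decay k + decay l], this is [0 <= 1 / (1 - exp (- u)) - 1 / u <= 1], which follows
    from [1 - u <= exp (- u) <= 1 / (1 + u)]. *)
Lemma gram_cauchy k l :
  0 <= gram k l - cauchy_coef (dist k l) <= weight k * weight l.
Proof.
rewrite -sum_decay /gram -mulrBr.
have w0 : 0 <= weight k * weight l by rewrite mulr_ge0 // ltW // weight_gt0.
suff /andP[h0 h1] : 0 <= (1 - eigenvalue k * eigenvalue l)^-1 -
    (decay k + decay l)^-1 <= 1 by rewrite mulr_ge0 //= ler_piMr.
rewrite /eigenvalue -expRD -opprD.
have u0 : 0 < decay k + decay l by rewrite addr_gt0 ?decay_gt0.
move: (decay k + decay l) u0 => u u0.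
have e1 : expR (- u) < 1 by rewrite expR_lt1 oppr_lt0.
have h1 : 1 - u <= expR (- u) by exact: expR_ge1Dx.
have h2 : expR (- u) * (1 + u) <= 1.
  by rewrite expRN mulrC ler_pdivrMr ?expR_gt0 // mul1r expR_ge1Dx.
move: (expR (- u)) e1 h1 h2 => e e1 h1 h2.
have v0 : 0 < 1 - e by rewrite subr_gt0.
have -> : (1 - e)^-1 - u^-1 = (u - (1 - e)) / ((1 - e) * u).
  by field; rewrite !gt_eqF.
have vu : 0 < (1 - e) * u by rewrite mulr_gt0.
rewrite ler_pdivrMr // mul1r; apply/andP; split; last by lra.
by apply: divr_ge0; [lra|exact: ltW].
Qed.

Lemma cauchy_coef_ge0 d : 0 <= cauchy_coef d.
Proof.
by rewrite divr_ge0 ?addr_ge0 ?exprn_ge0 ?invr_ge0.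
Qed.

Lemma cauchy_coef_le d : cauchy_coef d <= 4^-1 ^+ d.
Proof.
rewrite ler_pdivrMr; last by rewrite ltr_wpDr // exprn_ge0 // invr_ge0.
by rewrite ler_peMr ?exprn_ge0 ?invr_ge0 // lerDl exprn_ge0 ?invr_ge0.
Qed.

Lemma sum_weight_le K : \sum_(l < K) weight l <= 3^-1.
Proof.
rewrite /weight; under eq_bigr do rewrite exprS.
rewrite -mulr_sumr; have := geometric4_sum_le K; lra.
Qed.

Lemma row_sum_weight K k : \sum_(l < K) weight k * weight l <= 12^-1.
Proof.
rewrite -mulr_sumr.
have := sum_weight_le K.
have : weight k <= 4^-1.
  by rewrite /weight exprS ler_piMr ?invr_ge0 // exprn_ile1 ?invr_ge0 // invf_le1 ?ler1n.
have := ltW (weight_gt0 k).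
have : 0 <= \sum_(l < K) weight l by apply: sumr_ge0 => i _; exact/ltW/weight_gt0.
move=> S0 w0 hw hS; have := ler_pM w0 S0 hw hS; lra.
Qed.

(** In the majorant a row sums to at most [8/3 + 1/12 < 3]: twice the geometric sum [4/3], plus the
    perturbation. *)
Lemma gram_form_le K a : gram_form K a <= 3 * \sum_(k < K) a k ^+ 2.
Proof.
apply: le_trans (ler_norm _) _.
apply: (@schur_test _ (fun k l => 4^-1 ^+ dist k l + weight k * weight l)).
- move=> k l; have /andP[h1 h2] := gram_cauchy k l.
  have := cauchy_coef_ge0 (dist k l); have := cauchy_coef_le (dist k l).
  rewrite ler_norml => *; apply/andP; split; lra.
- by move=> k l; rewrite (mulrC (weight k)) /dist addnC.
- move=> k kK; rewrite big_split /=.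
  have hw := row_sum_weight K k.
  have := @sum_dist_le (fun d => 4^-1 ^+ d) _ K k _ geometric4_sum_le kK.
  move=> /(_ (fun d => exprn_ge0 d _)) h.
  suff : \sum_(l < K) 4^-1 ^+ dist k l <= 4 / 3 + 4 / 3 :> R by lra.
  by apply: h => //; lra.
Qed.

(* Row [j] of a banded matrix [V]; [V^T V] has the entries 353/1024, 15/64
   and 1/16 at distance 0, 1 and 2 from the diagonal, close to those of the
   Cauchy matrix, and subtracting it leaves a diagonally dominant matrix. *)
Definition band j k : R :=
  4^-1 * (j == k)%:R + 15/32 * (j == k.+1)%:R + 4^-1 * (j == k.+2)%:R.

Definition band_gram k l : R :=
  4^-1 * band k l + 15/32 * band k.+1 l + 4^-1 * band k.+2 l.

(** Column [k] of the band is supported in rows [k] to [k + 2]; with [K + 2] rows no column is cut,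
    so the product is exactly banded up to the boundary. *)
Lemma band_gramE K k l : (k < K)%N ->
  \sum_(j < K.+2) band j k * band j l = band_gram k l.
Proof.
move=> kK.
have pick i (g : nat -> R) : (i < K.+2)%N ->
    \sum_(j < K.+2) (nat_of_ord j == i)%:R * g j = g i.
  move=> iK; rewrite (bigD1 (Ordinal iK)) //= eqxx mul1r big1 ?addr0 //.
  by move=> j; rewrite -val_eqE /= => /negbTE ->; rewrite mul0r.
rewrite /band_gram.
have h0 : (k < K.+2)%N by lia.
have h1 : (k.+1 < K.+2)%N by lia.
have h2 : (k.+2 < K.+2)%N by lia.
rewrite -(pick k (fun j => band j l) h0) -(pick k.+1 (fun j => band j l) h1).
rewrite -(pick k.+2 (fun j => band j l) h2).
rewrite !mulr_sumr -big_split -big_split /=; apply: eq_bigr => j _.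
rewrite {1}/band; ring.
Qed.

(** The bound [1/1024] covers [4/17 - 15/64 = 1/1088] at distance 1 and [1/16 - 16/257 = 1/4112] at
    distance 2. At distance 0 the multiple [159/1024] of the identity makes the match exact, and
    from distance 3 on the band contributes nothing. *)
Definition band_error d : R :=
  match d with O => 0 | S O | S (S O) => 32^-1 * 32^-1 | _ => 4^-1 ^+ d end.

Lemma band_error_ge0 d : 0 <= band_error d.
Proof.
have h4 : 0 <= 4^-1 :> R by rewrite invr_ge0.
have h32 : 0 <= 32^-1 * 32^-1 :> R by rewrite mulr_ge0 ?invr_ge0.
by case: d => [|[|[|d]]]; [exact: lexx|exact: h32|exact: h32|exact: exprn_ge0].
Qed.

Lemma sum_band_error n : \sum_(d < n) band_error d <= 2 * (32^-1 * 32^-1) + 1/48.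
Proof.
apply: (@le_trans _ _ (\sum_(d < 3 + n) band_error d)).
  by rewrite addnC big_split_ord /= lerDl sumr_ge0 // => i _; exact: band_error_ge0.
rewrite big_split_ord /= 3!big_ord_recl big_ord0 /=.
rewrite (eq_bigr (fun i : 'I_n => 4^-1 ^+ 3 * 4^-1 ^+ i)); last first.
  by move=> i _; rewrite -exprD.
rewrite -mulr_sumr; have := geometric4_sum_le n; lra.
Qed.

Lemma band_gram_approx k l :
  `|cauchy_coef (dist k l) - band_gram k l - 159/32/32 * (k == l)%:R|
    <= band_error (dist k l).
Proof.
have e1 i : (i == i.+1) = false by apply/negbTE/eqP; lia.
have e1' i : (i.+1 == i) = false by apply/negbTE/eqP; lia.
have e2 i : (i == i.+2) = false by apply/negbTE/eqP; lia.
have e2' i : (i.+2 == i) = false by apply/negbTE/eqP; lia.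
have b0 i : band i i = 4^-1.
  by rewrite /band eqxx e1 e2 !mulr0 mulr1 !addr0.
have b1 i : band i.+1 i = 15/32.
  by rewrite /band eqxx e1' e1 !mulr0 mulr1 addr0 add0r.
have b2 i : band i.+2 i = 4^-1.
  by rewrite /band eqxx e2' e1' !mulr0 mulr1 !add0r.
have bz i j : i <> j -> i <> j.+1 -> i <> j.+2 -> band i j = 0.
  by move=> /eqP /negbTE h0 /eqP /negbTE h1 /eqP /negbTE h2;
    rewrite /band h0 h1 h2 !mulr0 !addr0.
have c0 : cauchy_coef 0 = 2^-1 by rewrite /cauchy_coef !expr0; field.
have c1 : cauchy_coef 1 = 4 / 17 by rewrite /cauchy_coef !expr1; field.
have c2 : cauchy_coef 2 = 16 / 257 by rewrite /cauchy_coef !expr2; field.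
have kl0 : k <> l -> (k == l)%:R = 0 :> R by move=> /eqP /negbTE ->.
have cases : k = l \/ k = l.+1 \/ l = k.+1 \/ k = l.+2 \/ l = k.+2 \/
  (2 < dist k l)%N by rewrite /dist; lia.
rewrite ler_norml.
case: cases => [->|[kl|[kl|[kl|[kl|d3]]]]].
- have -> : dist l l = 0%N by rewrite /dist subnn.
  rewrite /band_gram b0 b1 b2 eqxx c0 /=.
  by apply/andP; split; lra.
- rewrite kl0 /band_gram; last by lia.
  have -> : dist k l = 1%N by rewrite /dist; lia.
  rewrite c1 /=.
  rewrite kl b1 b2 (bz l.+3); try lia.
  by apply/andP; split; lra.
- rewrite kl0 /band_gram; last by lia.
  have -> : dist k l = 1%N by rewrite /dist; lia.
  rewrite c1 /=.
  rewrite kl b0 b1 (bz k); try lia.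
  by apply/andP; split; lra.
- rewrite kl0 /band_gram; last by lia.
  have -> : dist k l = 2%N by rewrite /dist; lia.
  rewrite c2 /=.
  rewrite kl b2 (bz l.+3) ?(bz l.+4); try lia.
  by apply/andP; split; lra.
- rewrite kl0 /band_gram; last by lia.
  have -> : dist k l = 2%N by rewrite /dist; lia.
  rewrite c2 /=.
  rewrite kl b0 (bz k) ?(bz k.+1); try lia.
  by apply/andP; split; lra.
rewrite kl0 /band_gram ?(bz k l) ?(bz k.+1 l) ?(bz k.+2 l);
  try by (move: d3; rewrite /dist; lia).
have -> : band_error (dist k l) = 4^-1 ^+ dist k l.
  by move: d3; case: (dist k l) => [|[|[|d]]].
have := cauchy_coef_le (dist k l); have := cauchy_coef_ge0 (dist k l).
by rewrite !mulr0 !addr0 !subr0 => *; apply/andP; split; lra.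
Qed.

(** Beyond the positive band part, the identity has coefficient [159/1024], against row sums of the
    error of at most [4/1024 + 1/24 + 1/12 = 132/1024]. The gap [27/1024] exceeds [1/40]. *)
Lemma gram_form_ge K a : 1/40 * \sum_(k < K) a k ^+ 2 <= gram_form K a.
Proof.
pose E k l := gram k l - band_gram k l - 159/32/32 * (k == l)%:R.
have hE : `|\sum_(k < K) \sum_(l < K) E k l * (a k * a l)| <=
    (4 * (32^-1 * 32^-1) + 1/24 + 12^-1) * \sum_(k < K) a k ^+ 2.
  apply: (@schur_test _ (fun k l => band_error (dist k l) + weight k * weight l)).
  - move=> k l; have /andP[h1 h2] := gram_cauchy k l.
    have := band_gram_approx k l.
    rewrite /E !ler_norml => /andP[]; lra.
  - by move=> k l; rewrite (mulrC (weight k)) /dist addnC.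
  - move=> k kK; rewrite big_split /=; have := row_sum_weight K k.
    have := sum_dist_le band_error_ge0 sum_band_error kK; lra.
have -> : gram_form K a = \sum_(k < K) \sum_(l < K) E k l * (a k * a l) +
    \sum_(j < K.+2) (\sum_(k < K) band j k * a k) ^+ 2 +
    159/32/32 * \sum_(k < K) a k ^+ 2.
  have -> : \sum_(j < K.+2) (\sum_(k < K) band j k * a k) ^+ 2 =
      \sum_(k < K) \sum_(l < K) band_gram k l * (a k * a l).
    under eq_bigr => j _ do rewrite expr2 mulr_suml.
    rewrite exchange_big /=; apply: eq_bigr => k _.
    under eq_bigr => j _ do rewrite mulr_sumr.
    rewrite exchange_big /=; apply: eq_bigr => l _.
    rewrite -(band_gramE l (ltn_ord k)) mulr_suml.
    by apply: eq_bigr => j _; ring.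
  have -> : 159/32/32 * \sum_(k < K) a k ^+ 2 =
      \sum_(k < K) \sum_(l < K) 159/32/32 * (k == l :> nat)%:R * (a k * a l).
    rewrite mulr_sumr; apply: eq_bigr => k _.
    rewrite (bigD1 k) //= eqxx big1 ?addr0 ?mulr1 ?expr2 //.
    by move=> l; rewrite -val_eqE eq_sym /= => /negbTE ->; rewrite mulr0 mul0r.
  rewrite -!big_split /=; apply: eq_bigr => k _; rewrite -!big_split /=.
  by apply: eq_bigr => l _; rewrite /E; ring.
have : 0 <= \sum_(j < K.+2) (\sum_(k < K) band j k * a k) ^+ 2.
  by apply: sumr_ge0 => j _; exact: sqr_ge0.
have : 0 <= \sum_(k < K) a k ^+ 2 by apply: sumr_ge0 => j _; exact: sqr_ge0.
move: hE; rewrite ler_norml => /andP[]; lra.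
Qed.

End GramForm.

(** * Sums over sets of times *)

Section UnconditionalSums.
Variable R : realType.
Implicit Types (g : R -> R) (s : seq R).

Lemma ler_sum_subset g s1 s2 : (forall t, 0 <= g t) -> uniq s1 ->
  {subset s1 <= s2} -> \sum_(t <- s1) g t <= \sum_(t <- s2) g t.
Proof.
move=> g0; elim: s2 s1 => [|x s2 IH] s1 us1 s12.
  by case: s1 us1 s12 => [|y s1] // _ /(_ y (mem_head _ _)).
rewrite big_cons; have [xs1|xs1] := boolP (x \in s1).
  rewrite (big_rem x) //= lerD2l; apply: IH; first exact: rem_uniq.
  move=> y; rewrite mem_rem_uniq // inE => /andP[/negbTE yx /s12].
  by rewrite inE yx.
rewrite -[leLHS]add0r; apply: lerD => //; apply: IH => // y ys1.
by have := s12 _ ys1; rewrite inE => /orP[/eqP yx|//]; rewrite -yx ys1 in xs1.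
Qed.

(** Every finite subset of [I] is contained in some [s M]. Repetitions in [s M] only increase the
    sum, [g] being nonnegative, so the lists may be plain concatenations of blocks. *)
Lemma esum_le_seq (I : set R) (s : nat -> seq R) g B :
  (forall t, 0 <= g t) ->
  (forall t, I t -> exists M, t \in s M) ->
  (forall M N, (M <= N)%N -> {subset s M <= s N}) ->
  (forall M, \sum_(t <- s M) g t <= B) ->
  (\esum_(t in I) (g t)%:E <= B%:E)%E.
Proof.
move=> g0 Is smono sB; apply: ge_ereal_sup => _ [F [finF FI] <-].
rewrite fsbig_finite //= sumEFin lee_fin.
suff [M hM] : exists M, {subset (fset_set F : seq R) <= s M}.
  by apply: le_trans (sB M); apply: ler_sum_subset => //; exact: fset_uniq.
have : forall t, t \in (fset_set F : seq R) -> I t.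
  by move=> t; rewrite in_fset_set // inE; exact: FI.
elim: (fset_set F : seq R) => [|x l IH] hl; first by exists 0%N.
have [|M hM] := IH; first by move=> t tl; apply: hl; rewrite inE tl orbT.
have /Is [N hN] := hl _ (mem_head _ _).
exists (maxn M N) => t; rewrite inE => /orP[/eqP ->|tl].
  exact: (smono _ _ (leq_maxr M N)).
exact: (smono _ _ (leq_maxl M N)) (hM _ tl).
Qed.

Lemma esum_ge_seq (I : set R) s g : (forall t, 0 <= g t) -> uniq s ->
  (forall t, t \in s -> I t) ->
  ((\sum_(t <- s) g t)%:E <= \esum_(t in I) (g t)%:E)%E.
Proof.
move=> g0 us sI; apply: esum_ge; exists [set` s].
  by split; [exact: finite_seq|move=> t /= /sI].
by rewrite -fsbig_seq // sumEFin lexx.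
Qed.

Lemma esum_natural_le g B : (forall t, 0 <= g t) ->
  (forall N, \sum_(n < N) g n%:R <= B) ->
  (\esum_(t in @natural_times R) (g t)%:E <= B%:E)%E.
Proof.
move=> g0 gB; apply: (@esum_le_seq _ (fun N => [seq n%:R | n <- iota 0 N])) => //.
- move=> _ [n _ <-]; exists n.+1; apply/mapP; exists n => //.
  by rewrite mem_iota add0n ltnS leqnn.
- move=> M N MN _ /mapP [n nM ->]; apply/mapP; exists n => //.
  by move: nM; rewrite !mem_iota !add0n /= => /leq_trans; apply.
- by move=> N; rewrite big_map -[N in iota _ N]subn0 big_mkord.
Qed.

Lemma esum_natural_ge g N : (forall t, 0 <= g t) ->
  ((\sum_(n < N) g n%:R)%:E <= \esum_(t in @natural_times R) (g t)%:E)%E.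
Proof.
move=> g0.
have -> : \sum_(n < N) g n%:R = \sum_(t <- [seq n%:R | n <- iota 0 N]) g t.
  by rewrite big_map -[N in iota _ N]subn0 big_mkord.
apply: esum_ge_seq => //; last by move=> _ /mapP [n _ ->]; exists n.
by rewrite map_inj_uniq ?iota_uniq // => m n /eqP; rewrite eqr_nat => /eqP.
Qed.

End UnconditionalSums.

(** * The observed system *)

Section RealResponse.
Variable R : realType.
Implicit Types (a : nat -> R) (k l n K N : nat) (t : R).

Definition real_sq_summable a : Prop := abs_summable (fun k => a k ^+ 2).

(** The scalar output at time [t] for real coefficients [a]. Weights and eigenvalues are real, so
    real and imaginary parts can be treated separately. *)
Definition response t a : R :=
  rsum (fun k => weight R k * (expR (- decay R k * t) * a k)).

Lemma expR_decay_le1 k t : 0 <= t -> expR (- decay R k * t) <= 1.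
Proof. by move=> t0; rewrite expR_le1 mulNr oppr_le0 mulr_ge0 // ltW // decay_gt0. Qed.

Lemma decay_summable : abs_summable (decay R).
Proof.
apply: (@abs_summable_ge0 _ _ (12^-1 * 16)) => [k|n]; first exact/ltW/decay_gt0.
under eq_bigr do rewrite /decay exprS.
rewrite -mulr_sumr.
have := @geometric_sum_le R 16^-1 n.
have h : (0 <= 16^-1 :> R) && (16^-1 < 1 :> R) by apply/andP; split; lra.
move=> /(_ h) h2; have : (1 - 16^-1)^-1 = 16 / 15 :> R by field.
by move=> h3; rewrite h3 in h2; lra.
Qed.

(** Termwise [w |a| <= w^2 + a^2], and the squared weights are the summable decay rates. *)
Lemma response_summable a t : 0 <= t -> real_sq_summable a ->
  abs_summable (fun k => weight R k * (expR (- decay R k * t) * a k)).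
Proof.
move=> t0 sa.
apply: abs_summable_le (abs_summableD 1 decay_summable sa) => k.
rewrite mul1r -[X in _ <= X + _]weight_sqr normrM normrM (ger0_norm (ltW (weight_gt0 R k))).
rewrite (ger0_norm (expR_ge0 _)).
have w0 := ltW (weight_gt0 R k).
apply: (@le_trans _ _ (weight R k * `|a k|)).
  apply: (ler_wpM2l w0); rewrite -[leRHS]mul1r.
  exact: (ler_wpM2r (normr_ge0 (a k)) (expR_decay_le1 k t0)).
rewrite -[X in _ <= _ + X]real_normK ?num_real //.
have := sqr_ge0 (weight R k - `|a k|); have := sqr_ge0 (weight R k); have := sqr_ge0 (`|a k|).
move: (weight R k) (`|a k|) => x y; lra.
Qed.

Lemma response_nat n a : response n%:R a =
  rsum (fun k => weight R k * (eigenvalue R k ^+ n * a k)).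
Proof.
rewrite /response; congr rsum; apply/funext => k.
by rewrite /eigenvalue expRM_natr.
Qed.

Lemma response_nat_cvg n a : real_sq_summable a ->
  (fun K => \sum_(k < K) weight R k * (eigenvalue R k ^+ n * a k)) @ \oo -->
  response n%:R a.
Proof.
move=> sa; have := abs_summable_cvg (response_summable (ler0n R n) sa).
rewrite /response /rsum => h.
rewrite (_ : (fun K => _) =
  series (fun k => weight R k * (expR (- decay R k * n%:R) * a k))) //.
apply/funext => K; rewrite series_ord; apply: eq_bigr => k _.
by rewrite /eigenvalue expRM_natr.
Qed.

(** For a finite section the telescoped sum is at most [gram_form K a], since the subtracted form is
    nonnegative; then [K] tends to infinity with [N] fixed. *)
Lemma response_nat_le N a : real_sq_summable a ->
  \sum_(n < N) response n%:R a ^+ 2 <= 3 * rsum (fun k => a k ^+ 2).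
Proof.
move=> sa.
pose f n K := (\sum_(k < K) weight R k * (eigenvalue R k ^+ n * a k)) ^+ 2.
have cv : (fun K => \sum_(n < N) f n K) @ \oo -->
    \sum_(n < N) response n%:R a ^+ 2.
  apply: (@cvg_sum_ord R N f (fun n => response n%:R a ^+ 2)) => n.
  have h := @response_nat_cvg n a sa.
  by rewrite expr2; exact: (cvgM h h).
rewrite -(cvg_lim _ cv) //; apply: limr_le; first exact: cvgP cv.
apply: nearW => K.
have := gram_form_telescope K a N.
have := gram_form_le K a.
have : 0 <= gram_form K (fun k => eigenvalue R k ^+ N * a k).
  apply: le_trans (gram_form_ge K _).
  by rewrite mulr_ge0 // ?divr_ge0 // sumr_ge0 // => i _; exact: sqr_ge0.
have := partial_le_rsum K (fun k => sqr_ge0 (a k)) sa.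
set S := (X in X = _ -> _) => h1 h2 h3 h4.
apply: (@le_trans _ _ S); last by lra.
by rewrite le_eqVlt; apply/orP; left; apply/eqP.
Qed.

(** The sequence is split into a head of length [K] and a tail [b]. The Gramian bounds the energy of
    the head from below over a long enough horizon, and the tail is too small to cancel it. The
    horizon [N] depends on [a], which is harmless for a sum over all natural times. *)
Lemma response_nat_ge a : real_sq_summable a -> exists N,
  rsum (fun k => a k ^+ 2) / 400 <= \sum_(n < N) response n%:R a ^+ 2.
Proof.
move=> sa; set A := rsum _.
have A0 : 0 <= A.
  by have := partial_le_rsum 0 (fun k => sqr_ge0 (a k)) sa; rewrite big_ord0.
have [->|An0] := eqVneq A 0; first by exists 0%N; rewrite big_ord0 mul0r.
have Agt0 : 0 < A by rewrite lt_def An0.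
(* The tail has mass at most [A / 2000], hence observed energy at most [3 A / 2000], small against
   [A / 40]. *)
have [K hK] : exists K, A - \sum_(k < K) a k ^+ 2 <= A / 40 / 50.
  have /cvgrPdist_le := abs_summable_cvg sa.
  move=> /(_ (A / 40 / 50)) []; first by rewrite !divr_gt0.
  move=> K _ /(_ K (leqnn K)) /=; rewrite series_ord => h.
  by exists K; apply: le_trans (ler_norm _) h.
(* The eigenvalues increase with the index, so this [N] serves all [k < K]. The unobserved remainder
   of the head is then at most [3/256] of its mass, below the [1/40] available. *)
have [N hN] : exists N, eigenvalue R K ^+ N <= 16^-1.
  have /cvgrPdist_le : (fun n => eigenvalue R K ^+ n) @ \oo --> (0 : R).
    apply: cvg_expr; have /andP[h0 h1] := eigenvalue_lt1 R K.
    by rewrite ger0_norm // ltW.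
  move=> /(_ 16^-1) []; first by rewrite invr_gt0.
  move=> N _ /(_ N (leqnn N)) /=; rewrite sub0r normrN => h.
  by exists N; apply: le_trans (ler_norm _) h.
exists N.
pose b k := if (k < K)%N then 0 else a k.
have sb : real_sq_summable b.
  apply: abs_summable_le sa => k; rewrite /b.
  by case: ifP => _; rewrite ?expr0n ?normr0 ?sqr_ge0 // ger0_norm ?sqr_ge0.
have bA : rsum (fun k => b k ^+ 2) = A - \sum_(k < K) a k ^+ 2.
  have [s1 e1] := @rsum_finite R K (fun k => a k ^+ 2 - b k ^+ 2) (fun k Kk =>
    ltac:(by rewrite /b ltnNge Kk /= subrr)).
  have -> : \sum_(k < K) a k ^+ 2 = \sum_(k < K) (a k ^+ 2 - b k ^+ 2).
    by apply: eq_bigr => k _; rewrite /b ltn_ord expr0n /= subr0.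
  rewrite -e1; have := rsumD 1 s1 sb.
  have -> : (fun k => 1 * (a k ^+ 2 - b k ^+ 2) + b k ^+ 2) = (fun k => a k ^+ 2).
    by apply/funext => k; ring.
  rewrite -/A => ->; ring.
have split n : response n%:R a =
    \sum_(k < K) weight R k * (eigenvalue R k ^+ n * a k) + response n%:R b.
  pose u k := weight R k * (eigenvalue R k ^+ n * (a k - b k)).
  have [s1 e1] := @rsum_finite R K u (fun k Kk =>
    ltac:(by rewrite /u /b ltnNge Kk /= subrr !mulr0)).
  have -> : \sum_(k < K) weight R k * (eigenvalue R k ^+ n * a k) = \sum_(k < K) u k.
    by apply: eq_bigr => k _; rewrite /u /b ltn_ord subr0.
  rewrite -e1 !response_nat -[rsum u]mul1r -rsumD //.
    by congr rsum; apply/funext => k; rewrite /u; ring.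
  have := response_summable (ler0n R n) sb.
  by congr abs_summable; apply/funext => k; rewrite /eigenvalue expRM_natr.
(* The head response is the response to [a] minus that to [b], and [x^2 <= 2 (x + y)^2 + 2 y^2]. *)
have S2 : \sum_(n < N) (\sum_(k < K) weight R k * (eigenvalue R k ^+ n * a k)) ^+ 2
    <= 2 * \sum_(n < N) response n%:R a ^+ 2 + 2 * \sum_(n < N) response n%:R b ^+ 2.
  rewrite !mulr_sumr -big_split /=; apply: ler_sum => n _; rewrite split.
  move: (\sum_(k < K) _) (response _ b) => x y.
  have := sqr_ge0 (x + 2 * y); lra.
have hb := response_nat_le N sb; rewrite bA in hb.
have hQ : gram_form K (fun k => eigenvalue R k ^+ N * a k) <=
    3 * (16^-1 * 16^-1 * \sum_(k < K) a k ^+ 2).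
  apply: le_trans (gram_form_le _ _) _; rewrite ler_pM2l // mulr_sumr.
  apply: ler_sum => k _; rewrite exprMn ler_wpM2r ?sqr_ge0 //.
  have h : eigenvalue R k ^+ N <= 16^-1.
    apply: le_trans hN; have /andP[h0 _] := eigenvalue_lt1 R k.
    have /andP[h0' _] := eigenvalue_lt1 R K.
    apply: lerXn2r; rewrite ?nnegrE ?(ltW h0) ?(ltW h0') //.
    rewrite ler_expR lerN2 /decay ler_wiXn2l ?invr_ge0 ?invf_le1 ?ler1n //.
    by rewrite ltnS; exact: ltnW.
  have h0 : 0 <= eigenvalue R k ^+ N.
    by rewrite exprn_ge0 // ltW //; case/andP: (eigenvalue_lt1 R k).
  by rewrite expr2; apply: ler_pM.
rewrite gram_form_telescope in S2.
have := gram_form_ge K a.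
have := partial_le_rsum K (fun k => sqr_ge0 (a k)) sa; rewrite -/A.
lra.
Qed.

End RealResponse.

(** * The diagonal system: exact observability over the natural numbers and separability *)

Section Observation.
Variable R : realType.
Notation C := R[i].
Notation l2 := (l2 R).
Implicit Types (x y : l2) (t : R).

Lemma rnorm_l2 x : rnorm (x : l2_hilbert R) ^+ 2 = l2nsq x.
Proof. by rewrite /rnorm /= sqr_sqrtr // l2nsq_ge0. Qed.

Definition weight_vec : l2 := l2_of (fun k => (weight R k)%:C%C).

Lemma nsq_real (r : R) : nsq (r%:C%C) = r ^+ 2.
Proof. by rewrite /nsq /= expr0n addr0. Qed.

Lemma weight_vecE k : weight_vec k = (weight R k)%:C%C.
Proof.
rewrite l2_ofE //; have := @decay_summable R; congr abs_summable.
by apply/funext => j; rewrite nsq_real weight_sqr.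
Qed.

(** The scalar output is placed along a unit vector so that [l2] also serves as the output space. *)
Definition observe x : l2 := l2dot x weight_vec *: l2_unit R 0.

Lemma l2nsq_observe x : l2nsq (observe x) = nsq (l2dot x weight_vec).
Proof. by rewrite /observe l2nsqZ l2nsq_unit mulr1. Qed.

Lemma re_sq_summable x : real_sq_summable (fun k => complex.Re (x k)).
Proof.
apply: abs_summable_le (l2P x) => k.
by rewrite ger0_norm ?sqr_ge0 // lerDl sqr_ge0.
Qed.

Lemma im_sq_summable x : real_sq_summable (fun k => complex.Im (x k)).
Proof.
apply: abs_summable_le (l2P x) => k.
by rewrite ger0_norm ?sqr_ge0 // lerDr sqr_ge0.
Qed.

Lemma l2nsq_re_im x : l2nsq x =
  rsum (fun k => complex.Re (x k) ^+ 2) + rsum (fun k => complex.Im (x k) ^+ 2).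
Proof.
have := rsumD 1 (re_sq_summable x) (im_sq_summable x).
rewrite mul1r => <-; congr rsum; apply/funext => k.
by rewrite mul1r.
Qed.

Definition diag_op : l2 -> l2 := diag (fun k => (eigenvalue R k)%:C%C).
Definition diag_cfc : (C -> C) -> l2 -> l2 := diag_calculus (eigenvalue R).

Definition semigroup t x : l2 := op_pow (H := l2_hilbert R) diag_cfc t x.

Lemma semigroupE t x k : 0 <= t ->
  semigroup t x k = (expR (- decay R k * t))%:C%C * x k.
Proof.
move=> t0; rewrite /semigroup /op_pow.
have [->|tn0] := eqVneq t 0; first by rewrite mulr0 expR0 mul1r.
rewrite /diag_cfc /diag_calculus diagE /=; last first.
  exists 1 => j; rewrite nsq_real /eigenvalue -expRM.
  by rewrite expr_le1 ?expR_ge0 // expR_decay_le1.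
by rewrite /eigenvalue -expRM.
Qed.

Lemma nsq_observation t x : 0 <= t ->
  rnorm (observe (semigroup t x) : l2_hilbert R) ^+ 2 =
  response t (fun k => complex.Re (x k)) ^+ 2 +
  response t (fun k => complex.Im (x k)) ^+ 2.
Proof.
move=> t0; rewrite rnorm_l2 l2nsq_observe /nsq /=; congr (_ ^+ 2 + _ ^+ 2);
  congr rsum; apply/funext => k; rewrite semigroupE // weight_vecE;
  by case: (x k) => a b /=; ring.
Qed.

(** At time 0 the semigroup is the identity, so boundedness is the case [N = 1] of the upper
    observability bound. *)
Lemma observe_bounded : @bounded_op R (l2 : normedModType C) (l2 : normedModType C) observe.
Proof.
have lo : linear observe.
  by move=> a x y; rewrite /observe l2dot_linear scalerDl scalerA.
split=> //; apply: (@l2_linear_continuous R observe 3) => // x.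
have := nsq_observation x (lexx 0); rewrite rnorm_l2.
rewrite (_ : semigroup 0 x = x) => [->|]; last by rewrite /semigroup /op_pow eqxx.
have := response_nat_le 1 (re_sq_summable x).
have := response_nat_le 1 (im_sq_summable x).
rewrite !big_ord1 l2nsq_re_im; lra.
Qed.

Lemma natural_observable_bounds x :
  ((1/400 * l2nsq x)%:E <= \esum_(t in @natural_times R)
     (rnorm (observe (semigroup t x) : l2_hilbert R) ^+ 2)%:E)%E /\
  (\esum_(t in @natural_times R)
     (rnorm (observe (semigroup t x) : l2_hilbert R) ^+ 2)%:E <=
   (3 * l2nsq x)%:E)%E.
Proof.
pose re k := complex.Re (x k); pose im k := complex.Im (x k).
pose g t := response t re ^+ 2 + response t im ^+ 2.
have g0 t : 0 <= g t by rewrite addr_ge0 ?sqr_ge0.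
have eg : \esum_(t in @natural_times R)
    (rnorm (observe (semigroup t x) : l2_hilbert R) ^+ 2)%:E =
    \esum_(t in @natural_times R) (g t)%:E.
  by apply: eq_esum => _ [n _ <-]; rewrite (nsq_observation x (ler0n _ n)).
rewrite eg l2nsq_re_im -/re -/im.
have le N M (a : nat -> R) : real_sq_summable a -> (N <= M)%N ->
    \sum_(n < N) response n%:R a ^+ 2 <= \sum_(n < M) response n%:R a ^+ 2.
  move=> _ /subnKC <-; rewrite big_split_ord /= lerDl sumr_ge0 // => i _.
  exact: sqr_ge0.
split; last first.
  apply: esum_natural_le => // N; rewrite /g big_split /=.
  have := response_nat_le N (re_sq_summable x).
  have := response_nat_le N (im_sq_summable x); rewrite -/re -/im; lra.
(* Real and imaginary parts come with different horizons; the partial sums increase, so the larger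
   one serves both. *)
have [N hN] := response_nat_ge (re_sq_summable x).
have [M hM] := response_nat_ge (im_sq_summable x).
apply: le_trans (esum_natural_ge (maxn N M) g0); rewrite lee_fin /g big_split /=.
have := le N _ _ (re_sq_summable x) (leq_maxl N M).
have := le M _ _ (im_sq_summable x) (leq_maxr N M).
rewrite -/re -/im in hN hM *; lra.
Qed.

Lemma natural_observable :
  exactly_observable (H := l2_hilbert R) (Y := l2_hilbert R)
    (fun t x => observe (op_pow (H := l2_hilbert R) diag_cfc t x)) (@natural_times R).
Proof.
exists (1/400), 3; split; [by lra|by lra|].
by move=> x; rewrite rnorm_l2; exact: natural_observable_bounds.
Qed.

Lemma eigenvalue01 k : 0 <= eigenvalue R k <= 1.
Proof. by have /andP[h0 h1] := eigenvalue_lt1 R k; rewrite !ltW. Qed.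

Lemma eigenvalue_cvg : eigenvalue R @ \oo --> (1 : R).
Proof.
have h : (fun k => - decay R k) @ \oo --> (0 : R).
  rewrite -oppr0; apply: cvgN; rewrite -(mulr0 16^-1).
  rewrite (_ : decay R = fun k => 16^-1 * 16^-1 ^+ k); last first.
    by apply/funext => k; rewrite /decay exprS.
  apply: cvgZr; apply: cvg_expr.
  by rewrite ger0_norm ?invr_ge0 // invf_lt1 ?ltr1n // ltr0n.
by rewrite -expR0; apply: (cvg_comp _ _ h); exact: continuous_expR.
Qed.

(** The dense set consists of the finitely supported sequences with rational real and imaginary
    parts, coded by finite lists. *)
Lemma l2_separable : separable_space (l2 : topologicalType).
Proof.
pose vec (s : seq (rat * rat)) : l2 :=
  l2_fin (size s) (fun k => Complex (ratr (nth (0, 0) s k).1) (ratr (nth (0, 0) s k).2)).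
exists (range vec); first exact: card_le_trans (card_image_le _ _) (countableP _).
move=> O [x Ox] oO.
have /nbhs_ballP [e /pos_complexP [r r0 ->] hO] : nbhs x O by apply: open_nbhs_nbhs.
pose A := l2nsq x.
have r20 : 0 < r ^+ 2 / 4 by rewrite divr_gt0 // exprn_gt0.
have [K hK] : exists K, A - \sum_(k < K) nsq (x k) <= r ^+ 2 / 4.
  have /cvgrPdist_le := abs_summable_cvg (l2P x).
  move=> /(_ _ r20) [K _ /(_ K (leqnn K))] /=; rewrite series_ord => h.
  by exists K; apply: le_trans (ler_norm _) h.
(* Each coordinate costs at most [2 eta^2], so the head costs at most [r^2 / 4], as does the tail.
   Dividing by [K + 1] keeps [eta] positive when [K = 0]. *)
pose eta := Num.sqrt (r ^+ 2 / 8 / K.+1%:R).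
have eta0 : 0 < eta by rewrite sqrtr_gt0 divr_gt0 // divr_gt0 // exprn_gt0.
have approx (z : R) : exists q : rat, (z - ratr q) ^+ 2 <= r ^+ 2 / 8 / K.+1%:R.
  have [q] := @rat_in_itvoo R (z - eta) z (ltac:(by rewrite gtrBl)).
  rewrite in_itv /= => /andP[q1 q2]; exists q.
  rewrite -[leRHS]sqr_sqrtr; last by rewrite !divr_ge0 // ?sqr_ge0.
  rewrite -/eta ler_sqr ?nnegrE ?subr_ge0 ?ltW //.
  by rewrite ltrBlDr addrC -ltrBlDr.
have /choice [q hq] := approx.
pose s := [seq (q (complex.Re (x k)), q (complex.Im (x k))) | k <- iota 0 K].
have ss : size s = K by rewrite size_map size_iota.
exists (vec s); split; last by exists s.
apply: hO; apply/l2_ballE => //.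
have vs k : vec s k = if (k < K)%N then
    Complex (ratr (q (complex.Re (x k)))) (ratr (q (complex.Im (x k)))) else 0.
  rewrite /vec l2_finE ss; case: ifP => // kK.
  by rewrite (nth_map 0%N) ?size_iota // nth_iota.
(* From index [K] on, [x - vec s] agrees with [x], so the two squared norms differ by a finite
   sum. *)
have far k : (K <= k)%N -> nsq (x k) - nsq ((x - vec s) k) = 0.
  by move=> Kk; rewrite l2D l2N vs ltnNge Kk /= subr0 subrr.
have [s1 e1] := rsum_finite far.
have : A = rsum (fun k => nsq (x k) - nsq ((x - vec s) k)) + l2nsq (x - vec s).
  rewrite -[X in X + _]mul1r -(rsumD 1 s1 (l2P (x - vec s))).
  by congr rsum; apply/funext => k; rewrite mul1r subrK.
rewrite e1 sumrB.
have : \sum_(k < K) nsq ((x - vec s) k) <= r ^+ 2 / 4.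
  pose w := r ^+ 2 / 8 / K.+1%:R.
  have w0 : 0 <= w by rewrite divr_ge0 ?divr_ge0 ?sqr_ge0.
  apply: (@le_trans _ _ (\sum_(k < K) (w + w))).
    apply: ler_sum => k _; rewrite l2D l2N vs ltn_ord /nsq.
    have := hq (complex.Re (x k)); have := hq (complex.Im (x k)).
    by case: (x k) => a b /= h1 h2; apply: lerD.
  rewrite sumr_const card_ord; apply: (@le_trans _ _ ((w + w) *+ K.+1)).
    by rewrite mulrS lerDr; exact: addr_ge0.
  have wE : w * K.+1%:R = r ^+ 2 / 8 by rewrite divfK // pnatr_eq0.
  by rewrite -mulr_natr mulrDl wE; lra.
have : 0 < r ^+ 2 by rewrite exprn_gt0.
move: hK; lra.
Qed.

End Observation.

(** * Density of the time set *)

Section TimePoints.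
Variables (R : realType) (c0 : R).
Hypothesis c0_bounds : 1 < c0 < 16.
Implicit Types (m l M N : nat).

Definition time_point m l : R := c0 * 16%:R ^+ m + l%:R * 16%:R ^- (2 * m).

Definition time_block m : seq R := [seq time_point m l | l <- iota 1 (16 ^ m)].

Definition time_list M : seq R :=
  0 :: flatten [seq time_block m | m <- iota 0 M].

Lemma pow16_gt0 m : 0 < 16%:R ^+ m :> R.
Proof. by rewrite exprn_gt0 // ltr0n. Qed.

Lemma time_point_bounds m l : (l <= 16 ^ m)%N ->
  0 <= time_point m l - c0 * 16%:R ^+ m <= 16%:R ^- m.
Proof.
move=> lm; rewrite /time_point addrC addKr.
have p := pow16_gt0 m; have p2 := pow16_gt0 (2 * m).
rewrite mulr_ge0 ?invr_ge0 ?(ltW p2) //=.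
rewrite ler_pdivrMr // mul2n -addnn exprD mulKf ?gt_eqF //.
by rewrite -natrX ler_nat.
Qed.

Lemma time_point_ge m l : 16%:R ^+ m <= time_point m l.
Proof.
have /andP[c1 _] := c0_bounds; have p := pow16_gt0 m.
rewrite /time_point -[leLHS]addr0; apply: lerD; first by rewrite ler_peMl // ltW.
by rewrite mulr_ge0 // invr_ge0 ltW // pow16_gt0.
Qed.

Lemma time_point_le m l : (l <= 16 ^ m)%N -> time_point m l <= 17 * 16%:R ^+ m.
Proof.
move=> /time_point_bounds /andP[_ h].
have /andP[_ c2] := c0_bounds; have p := pow16_gt0 m.
have h1 : (16%:R ^- m : R) <= 16%:R ^+ m.
  apply: (@le_trans _ _ 1); last by rewrite exprn_ege1 // ler1n.
  by rewrite invf_le1 // exprn_ege1 // ler1n.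
have : c0 * 16%:R ^+ m <= 16 * 16%:R ^+ m by rewrite ler_wpM2r // ltW.
lra.
Qed.

Lemma mem_time_list t M : reflect (t = 0 \/ exists m l,
    [/\ (m < M)%N, (1 <= l <= 16 ^ m)%N & t = time_point m l])
  (t \in time_list M).
Proof.
rewrite inE; apply: (iffP orP) => -[].
- by move=> /eqP ->; left.
- move=> /flattenP [_ /mapP [m mM ->] /mapP [l lm ->]]; right; exists m, l.
  move: mM lm; rewrite !mem_iota add0n => /andP[_ ->].
  by rewrite add1n ltnS.
- by move=> ->; left.
- move=> [m [l [mM lm ->]]]; right; apply/flattenP; exists (time_block m).
    by apply/mapP; exists m => //; rewrite mem_iota.
  by apply/mapP; exists l => //; rewrite mem_iota add1n ltnS.
Qed.

Lemma time_setP t : time_set 16 c0 t <-> exists M, t \in time_list M.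
Proof.
split=> [[->|[m _ [l lm <-]]]|[M /mem_time_list [->|[m [l [_ lm ->]]]]]].
- by exists 0%N; rewrite mem_head.
- by exists m.+1; apply/mem_time_list; right; exists m, l.
- by left.
- by right; exists m => //; exists l.
Qed.

Lemma time_set_ge0 t : time_set 16 c0 t -> 0 <= t.
Proof.
move=> /time_setP [M /mem_time_list [->//|[m [l [_ _ ->]]]]].
by apply: le_trans (time_point_ge m l); rewrite ltW // pow16_gt0.
Qed.

Lemma sub_time_list M N : (M <= N)%N -> {subset time_list M <= time_list N}.
Proof.
move=> MN t /mem_time_list [->|[m [l [mM lm ->]]]]; apply/mem_time_list.
  by left.
by right; exists m, l; split => //; exact: leq_trans mM MN.
Qed.

Lemma big_time_list (g : R -> R) M : \sum_(t <- time_list M) g t =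
  g 0 + \sum_(m < M) \sum_(t <- time_block m) g t.
Proof.
rewrite big_cons big_flatten big_map; congr (_ + _).
by rewrite -[M in iota _ M]subn0 big_mkord.
Qed.

Lemma size_time_list M : size (time_list M) = (1 + \sum_(m < M) 16 ^ m)%N.
Proof.
rewrite -sum1_size big_cons big_flatten big_map; congr (_ + _)%N.
rewrite -[M in iota _ M]subn0 big_mkord; apply: eq_bigr => m _.
by rewrite sum1_size size_map size_iota.
Qed.

Lemma time_block_uniq m : uniq (time_block m).
Proof.
rewrite map_inj_uniq ?iota_uniq // => l l' /addrI /mulIf.
have p := pow16_gt0 (2 * m).
rewrite invr_eq0 gt_eqF // => /(_ isT) /eqP.
by rewrite eqr_nat => /eqP.
Qed.

Lemma sub_time_block m t : t \in time_block m ->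
  time_set 16 c0 t /\ t <= 17 * 16%:R ^+ m.
Proof.
move=> /mapP [l lm ->]; move: lm; rewrite mem_iota add1n ltnS => lm; split.
  by apply/time_setP; exists m.+1; apply/mem_time_list; right; exists m, l.
by apply: time_point_le; case/andP: lm.
Qed.

Lemma time_set_truncated r M : r < 16%:R ^+ M ->
  time_set 16 c0 `&` `[0, r] `<=` [set` time_list M].
Proof.
move=> rM t [/time_setP [N /mem_time_list [->|[m [l [_ lm te]]]]]].
  by move=> _ /=; rewrite mem_head.
rewrite /= in_itv /= => /andP[_ tr]; apply/mem_time_list; right; exists m, l.
split => //; rewrite ltnNge; apply/negP => Mm.
have := time_point_ge m l; rewrite -te => h.
have : 16%:R ^+ M <= 16%:R ^+ m :> R by rewrite ler_eXn2l // ltr1n.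
lra.
Qed.

Lemma pow16_bracket (r : R) : 1 <= r ->
  exists m, 16%:R ^+ m <= r < 16%:R ^+ m.+1.
Proof.
move=> r1.
have ex : exists m, r < 16%:R ^+ m.
  exists (Num.truncn r).+1.
  apply: lt_le_trans (truncnS_gt r) _.
  by rewrite -natrX ler_nat ltnW // ltn_expl.
case: (ex_minnP ex) => -[|m]; first by rewrite expr0 ltNge r1.
move=> rm hm; exists m; rewrite rm andbT leNgt; apply/negP => h.
by have := hm _ h; rewrite ltnn.
Qed.

Lemma pow16_sum_le m : (\sum_(j < m.+1) (16 ^ j)%:R : R) <= 2 * 16%:R ^+ m.
Proof.
elim: m => [|m IH]; first by rewrite big_ord1 expn0 expr0; lra.
rewrite big_ord_recr /= natrX exprS; have := pow16_gt0 m; lra.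
Qed.

Lemma time_set_finite r : finite_set (time_set 16 c0 `&` `[0, r]).
Proof.
have [r1|r1] := leP 1 r; last first.
  apply: sub_finite_set (@time_set_truncated r 0 _) (finite_seq _).
  by rewrite expr0.
have [m /andP[_ rm]] := pow16_bracket r1.
exact: sub_finite_set (time_set_truncated rm) (finite_seq _).
Qed.

(** If [16^m <= r < 16^(m+1)], only the origin and the blocks up to [m] can contribute: at most
    [1 + 2 * 16^m <= 3 r] points. *)
Lemma counting_time_set_le r : 1 <= r ->
  (counting_function (time_set 16 c0) r)%:R <= 3 * r.
Proof.
move=> r1; have [m /andP[mr rm]] := pow16_bracket r1.
have : (counting_function (time_set 16 c0) r <= size (time_list m.+1))%N.
  apply: uniq_leq_size; first exact: fset_uniq.
  move=> t; rewrite in_fset_set; last exact: time_set_finite.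
  by rewrite inE => /(time_set_truncated rm).
rewrite -(ler_nat R) size_time_list natrD natr_sum.
have := pow16_sum_le m; lra.
Qed.

(** One block suffices. With [16^m <= r / 256 < 16^(m+1)] its points lie below [17 * 16^m <= r], and
    there are [16^m > r / 16^3] of them. *)
Lemma counting_time_set_ge r : 16 * 16 <= r ->
  16^-1 ^+ 3 * r <= (counting_function (time_set 16 c0) r)%:R.
Proof.
move=> r1; have r2 : 1 <= r / (16 * 16) by rewrite ler_pdivlMr; lra.
have [m /andP[mr rm]] := pow16_bracket r2.
apply: (@le_trans _ _ (16 ^ m)%:R).
  rewrite natrX; move: rm; rewrite exprS !exprS expr0; lra.
rewrite ler_nat -[X in (X <= _)%N](size_iota 1) -(size_map (time_point m)).
apply: uniq_leq_size; first exact: time_block_uniq.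
move=> t tm; rewrite in_fset_set; last exact: time_set_finite.
have [Tt t17] := sub_time_block tm.
rewrite inE; split => //=; rewrite in_itv /= time_set_ge0 //=.
apply: le_trans t17 _; move: mr; rewrite ler_pdivlMr; last by lra.
have := pow16_gt0 m; lra.
Qed.

End TimePoints.

(** * Abel means of the time set *)

Section AbelMeans.
Variables (R : realType) (c0 : R).
Hypothesis c0_bounds : 1 < c0 < 16.

(** In [1 - rho^n = (1 - rho) (1 + rho + ... + rho^(n-1))] each of the [n] powers is at least
    [rho^n]. *)
Lemma one_subX_ge (rho : R) n : 0 <= rho <= 1 ->
  n%:R * ((1 - rho) * rho ^+ n) <= 1 - rho ^+ n.
Proof.
move=> /andP[h0 h1]; elim: n => [|n IH]; first by rewrite mul0r expr0 subrr.
have p0 : 0 <= rho ^+ n by exact: exprn_ge0.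
have p1 : rho ^+ n <= 1 by exact: exprn_ile1.
have q1 : rho * rho ^+ n <= 1 by rewrite mulr_ile1.
rewrite exprS -natr1 mulrDl mul1r.
have := ler_wpM2l h0 IH.
have h2 : 0 <= 1 - rho by rewrite subr_ge0.
have := ler_wpM2l h2 q1; nra.
Qed.

(** The previous bound with [n = 15 a], multiplied by [rho^a]; the right-hand side telescopes when
    [a] runs through the powers of 16. *)
Lemma abel_block_le (rho : R) (a : nat) : 0 <= rho <= 1 ->
  (1 - rho) * ((16 * a)%:R * rho ^+ (16 * a)) <=
  16 / 15 * (rho ^+ a - rho ^+ (16 * a)).
Proof.
move=> rho01; have := one_subX_ge (15 * a) rho01.
have /andP[h0 h1] := rho01.
have -> : (16 * a = a + 15 * a)%N by rewrite -mulSn.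
rewrite exprD natrD natrM => /(ler_wpM2l (exprn_ge0 a h0)).
move: (rho ^+ a) (rho ^+ (15 * a)) => x y; lra.
Qed.

Lemma abel_sum_le (rho : R) M : 0 <= rho <= 1 ->
  (1 - rho) * \sum_(m < M) ((16 ^ m)%:R * rho ^+ (16 ^ m)) <= 3.
Proof.
move=> rho01; have /andP[h0 h1] := rho01.
case: M => [|M]; first by rewrite big_ord0 mulr0.
have : (1 - rho) * \sum_(m < M.+1) ((16 ^ m)%:R * rho ^+ (16 ^ m)) <=
    1 + 16 / 15 * (rho - rho ^+ (16 ^ M)).
  elim: M => [|M IH].
    rewrite big_ord1 expn0 mul1r expr1 subrr mulr0 addr0.
    by have := sqr_ge0 rho; lra.
  rewrite big_ord_recr mulrDr /= expnS.
  have := abel_block_le (16 ^ M) rho01; lra.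
have : 0 <= rho ^+ (16 ^ M) by exact: exprn_ge0.
lra.
Qed.

Lemma powR_natmul (r : R) n : 0 <= r -> r `^ (2 * n%:R) = (r ^+ 2) ^+ n.
Proof. by move=> r0; rewrite -natrM powR_mulrn // exprM. Qed.

(** The points of block [m] are at least [16^m], so their terms are at most [r^(2 * 16^m)]. The
    bound 4 is 1 for the origin plus 3 for the blocks. *)
Lemma abel_mean_le r : 0 < r < 1 ->
  ((1 - r ^+ 2)%:E * (\esum_(t in time_set 16 c0) (r `^ (2 * t))%:E) <= 4%:E)%E.
Proof.
move=> /andP[r0 r1].
have u0 : 0 < 1 - r ^+ 2 by rewrite subr_gt0 exprn_ilt1 // ltW.
have rho01 : 0 <= r ^+ 2 <= 1 by rewrite sqr_ge0 -subr_ge0 ltW.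
have : (\esum_(t in time_set 16 c0) (r `^ (2 * t))%:E <=
    (4 / (1 - r ^+ 2))%:E)%E.
  apply: (@esum_le_seq _ _ (time_list c0)).
  - by move=> t; exact: powR_ge0.
  - by move=> t /(time_setP c0).
  - by move=> M N; exact: sub_time_list.
  move=> M; rewrite big_time_list mulr0 powRr0 ler_pdivlMr // mulrC mulrDr mulr1.
  have hS : \sum_(m < M) \sum_(t <- time_block c0 m) r `^ (2 * t) <=
      \sum_(m < M) ((16 ^ m)%:R * (r ^+ 2) ^+ (16 ^ m)).
    apply: ler_sum => m _; rewrite big_map.
    apply: (@le_trans _ _ (\sum_(l <- iota 1 (16 ^ m)) (r ^+ 2) ^+ (16 ^ m))).
      apply: ler_sum => l _; rewrite -powR_natmul ?(ltW r0) //.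
      rewrite ger_powR ?r0 ?(ltW r1) // ler_pM2l // natrX.
      exact: time_point_ge.
    by rewrite big_const_seq count_predT size_iota iter_addr_0 mulr_natl.
  have := abel_sum_le M rho01; have := ler_wpM2l (ltW u0) hS.
  have := sqr_ge0 r; lra.
move=> /(@lee_wpmul2l _ (1 - r ^+ 2)%:E); rewrite lee_fin => /(_ (ltW u0)).
by rewrite -EFinM mulrCA divff ?mulr1 // gt_eqF.
Qed.

(** With [u = 1 - r^2], the block at scale [16^m] comparable to [1 / u] is enough. Its points are at
    most [17 * 16^m], so each term is at least [exp (- 34 u 16^m) >= exp (- 34)], and
    [u 16^m >= 1/16]. *)
Lemma abel_mean_ge r : 0 < r < 1 ->
  ((expR (- 34) / 16)%:E <=
   (1 - r ^+ 2)%:E * (\esum_(t in time_set 16 c0) (r `^ (2 * t))%:E))%E.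
Proof.
move=> /andP[r0 r1].
have u0 : 0 < 1 - r ^+ 2 by rewrite subr_gt0 exprn_ilt1 // ltW.
have rho01 : 0 <= r ^+ 2 <= 1 by rewrite sqr_ge0 -subr_ge0 ltW.
have e1 : expR (- 34) <= 1 :> R by rewrite expR_le1 oppr_le0.
have e0 : 0 < expR (- 34) :> R by exact: expR_gt0.
suff [s us [sT hs]] : exists2 s : seq R, uniq s &
    (forall t, t \in s -> time_set 16 c0 t) /\
    expR (- 34) / 16 <= (1 - r ^+ 2) * \sum_(t <- s) r `^ (2 * t).
  apply: (@le_trans _ _ ((1 - r ^+ 2)%:E * (\sum_(t <- s) r `^ (2 * t))%:E)%E).
    by rewrite -EFinM lee_fin.
  apply: lee_wpmul2l; first by rewrite lee_fin ltW.
  by apply: esum_ge_seq => // t; exact: powR_ge0.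
set u := 1 - r ^+ 2 in u0 *.
(* For [u > 1/2] the origin alone suffices; [u <= 1/2] is what makes [1 - u >= exp (- 2 u)] provable
   from [(1 - u) (1 + 2 u) >= 1]. *)
have [u2|u2] := leP u 2^-1; last first.
  exists [:: 0] => //; split; first by move=> t; rewrite inE => /eqP ->; left.
  by rewrite big_seq1 mulr0 powRr0 mulr1; lra.
have [m /andP[mu um]] : exists m, 16%:R ^+ m <= u^-1 < 16%:R ^+ m.+1.
  by apply: pow16_bracket; rewrite invf_ge1 //; lra.
exists (time_block c0 m); first exact: time_block_uniq.
split; first by move=> t /(sub_time_block c0_bounds) [].
have hrho : expR (- (2 * u)) <= r ^+ 2.
  have -> : r ^+ 2 = 1 - u by rewrite /u; ring.
  rewrite expRN -div1r ler_pdivrMr ?expR_gt0 //.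
  have h1 : 1 + 2 * u <= expR (2 * u) by exact: expR_ge1Dx.
  have h2 : 0 <= 1 - u by lra.
  apply: le_trans (ler_wpM2l h2 h1); nra.
have pm := pow16_gt0 R m.
have mu1 : u * 16%:R ^+ m <= 1 by rewrite mulrC -ler_pdivlMr // div1r.
have hS : 16%:R ^+ m * expR (- 34) <= \sum_(t <- time_block c0 m) r `^ (2 * t).
  rewrite big_map.
  apply: (@le_trans _ _ (\sum_(l <- iota 1 (16 ^ m)) expR (- 34))).
    by rewrite big_const_seq count_predT size_iota iter_addr_0 -natrX mulr_natl.
  rewrite big_seq [leRHS]big_seq; apply: ler_sum => l.
  rewrite mem_iota add1n ltnS => /andP[_ lm].
  apply: (@le_trans _ _ ((r ^+ 2) ^+ (17 * 16 ^ m))); last first.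
    rewrite -powR_natmul ?(ltW r0) // ger_powR ?r0 ?(ltW r1) // ler_pM2l //.
    by rewrite natrM natrX; exact: time_point_le.
  apply: (@le_trans _ _ (expR (- (2 * u)) ^+ (17 * 16 ^ m))); last first.
    by apply: lerXn2r; rewrite ?nnegrE ?expR_ge0 ?sqr_ge0.
  rewrite -expRM_natl ler_expR natrM natrX; lra.
have := ler_wpM2l (ltW u0) hS.
have : 1 <= u * (16 * 16%:R ^+ m).
  by rewrite mulrC -ler_pdivrMr // div1r -exprS ltW.
move: (16%:R ^+ m) => x h1 h2; apply: le_trans h2.
have := ler_wpM2r (ltW e0) h1; lra.
Qed.

End AbelMeans.

(** * Failure of observability on the time set *)

Section AlternatingSums.
Variables (R : realType) (c0 : R).
Hypothesis c0_bounds : 1 < c0 < 16.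
Implicit Types (m n j k K M : nat) (t : R).

Definition pos_term n : R := Hq_term 16 c0 n%:Z.
Definition neg_term n : R := Hq_term 16 c0 (- n.+1%:Z).

Lemma powR16_half (x : R) : 16 `^ (x / 2) = 4 `^ x.
Proof.
have -> : 16 = 4 `^ 2 :> R by rewrite -[2]/(2%:R) powR_mulrn // expr2; ring.
by rewrite -powRrM mulrC divfK // pnatr_eq0.
Qed.

Lemma pos_termE n :
  pos_term n = (-1) ^+ n * 4 ^+ n * expR (- (c0 * 16 ^+ n)).
Proof. by rewrite /pos_term /Hq_term powR16_half powR_mulrn. Qed.

Lemma neg_termE n : neg_term n =
  (-1) ^+ n.+1 * 4^-1 ^+ n.+1 * expR (- (c0 * 16^-1 ^+ n.+1)).
Proof.
rewrite /neg_term /Hq_term powR16_half mulrNz powRN powR_mulrn //.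
rewrite !exprVn -!exprnN; congr (_ * _ * _).
by rewrite -exprVn invrN1.
Qed.

Lemma expRN_le_inv (y : R) : 0 < y -> expR (- y) <= y^-1.
Proof.
move=> y0; rewrite expRN lef_pV2 ?posrE ?expR_gt0 //.
by have := expR_ge1Dx y; lra.
Qed.

(** The crude bound [exp (- y) <= 1 / y] at [y = c0 16^n] turns the growth [4^n] into the decay
    [4^-n], the rate of the negative half of the series. *)
Lemma pos_term_le n : `|pos_term n| <= 4^-1 ^+ n.
Proof.
have /andP[c1 _] := c0_bounds.
rewrite pos_termE !normrM !normrX normrN1 expr1n mul1r.
rewrite (ger0_norm (expR_ge0 _)) (@ger0_norm _ 4) //.
have p : 0 < 16 ^+ n :> R by exact: exprn_gt0.
have y0 : 0 < c0 * 16 ^+ n by rewrite mulr_gt0 //; lra.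
have q : 0 <= 4 ^+ n :> R by exact: exprn_ge0.
apply: le_trans (ler_wpM2l q (expRN_le_inv y0)) _.
rewrite ler_pdivrMr //.
have -> : (4^-1 : R) ^+ n * (c0 * 16 ^+ n) = c0 * 4 ^+ n.
  by rewrite mulrCA -exprMn; congr (_ * _ ^+ _); field.
by rewrite ler_peMl // ltW.
Qed.

Lemma neg_term_le n : `|neg_term n| <= 4^-1 * 4^-1 ^+ n.
Proof.
have /andP[c1 _] := c0_bounds.
rewrite neg_termE !normrM !normrX normrN1 expr1n mul1r -exprS.
rewrite (ger0_norm (expR_ge0 _)) (@ger0_norm _ 4^-1) ?invr_ge0 //.
have q : 0 <= 4^-1 ^+ n.+1 :> R by rewrite exprn_ge0 ?invr_ge0.
rewrite -[leRHS]mulr1; apply: (ler_wpM2l q).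
rewrite expR_le1 oppr_le0 mulr_ge0 ?exprn_ge0 ?invr_ge0 //; lra.
Qed.

Lemma sum_ord_subn (u : nat -> R) m n : (m <= n)%N ->
  \sum_(k < n) u k = \sum_(k < m) u k + \sum_(i < n - m) u (m + i)%N.
Proof. by move=> mn; rewrite -[in LHS](subnKC mn) big_split_ord. Qed.

Lemma normr_signX k : `|(-1) ^+ k| = 1 :> R.
Proof. by rewrite normrX normrN1 expr1n. Qed.

Lemma normr_sign_scale k m (x : R) :
  `|(-1) ^+ k * 4^-1 ^+ m * x| = 4^-1 ^+ m * `|x|.
Proof.
by rewrite !normrM normr_signX mul1r (@ger0_norm _ (4^-1 ^+ m)) ?exprn_ge0 ?invr_ge0.
Qed.

Lemma geometric4_tail (u : nat -> R) (B : R) m : 0 <= B ->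
  (forall k, `|u k| <= B * 4^-1 ^+ k) ->
  `|\sum_(k < m) u k - limn (series u)| <= 4 / 3 * B * 4^-1 ^+ m.
Proof.
move=> B0 uB.
have su : abs_summable u.
  exists (B * (4 / 3)) => n; apply: (@le_trans _ _ (\sum_(k < n) B * 4^-1 ^+ k)).
    by apply: ler_sum => k _.
  by rewrite -mulr_sumr ler_wpM2l // geometric4_sum_le.
have cu := abs_summable_cvg su.
have cv : (fun n => `|\sum_(k < m) u k - series u n|) @ \oo -->
    `|\sum_(k < m) u k - limn (series u)|.
  by apply: cvg_norm; apply: cvgB; [exact: cvg_cst|exact: cu].
rewrite -(cvg_lim _ cv) //; apply: limr_le; first exact: cvgP cv.
exists m => // n /= mn; rewrite series_ord distrC.
rewrite (sum_ord_subn u mn) addrAC subrr add0r.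
apply: le_trans (ler_norm_sum _ _ _) _.
apply: (@le_trans _ _ (\sum_(i < n - m) B * 4^-1 ^+ m * 4^-1 ^+ i)).
  by apply: ler_sum => i _; rewrite -mulrA -exprD.
have -> : 4 / 3 * B * 4^-1 ^+ m = B * 4^-1 ^+ m * (4 / 3) by ring.
rewrite -mulr_sumr; apply: ler_wpM2l.
  by rewrite mulr_ge0 ?exprn_ge0 ?invr_ge0.
exact: geometric4_sum_le.
Qed.

Definition alternating K t : R :=
  \sum_(k < K) weight R k * (expR (- decay R k * t) * (-1) ^+ k).

Lemma decay_shift m k : (k < m)%N ->
  decay R k * (c0 * 16 ^+ m) = c0 * 16 ^+ (m - k.+1).
Proof.
move=> km; rewrite /decay mulrCA; congr (_ * _).
rewrite -[in LHS](subnKC km) exprD mulrA -exprMn mulVf ?pnatr_eq0 //.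
by rewrite expr1n mul1r.
Qed.

Lemma decay_shift_neg m j :
  decay R (m + j) * (c0 * 16 ^+ m) = c0 * 16^-1 ^+ j.+1.
Proof.
rewrite /decay mulrCA; congr (_ * _).
rewrite -addnS exprD mulrAC -exprMn mulVf ?pnatr_eq0 //.
by rewrite expr1n mul1r.
Qed.

Lemma signr_sub m k : (k < m)%N ->
  (-1) ^+ k = (-1) ^+ m.+1 * (-1) ^+ (m - k.+1) :> R.
Proof.
move=> km; rewrite -exprD -signr_odd -[RHS]signr_odd; congr (_ ^+ _).
by congr (nat_of_bool _); lia.
Qed.

(** The index [k] of an eigenvalue corresponds to the index [n = m - k - 1] of the series, so
    [k < m] gives [n >= 0]; [neg_window] treats [k = m + j], where [n = - (j + 1)]. *)
Lemma pos_window m k : (k < m)%N ->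
  weight R k * (expR (- decay R k * (c0 * 16 ^+ m)) * (-1) ^+ k) =
  (-1) ^+ m.+1 * 4^-1 ^+ m * pos_term (m - k.+1).
Proof.
move=> km; rewrite mulNr decay_shift // pos_termE (signr_sub km).
have -> : weight R k = 4^-1 ^+ m * 4 ^+ (m - k.+1).
  rewrite /weight -[in RHS](subnKC km) addKn exprD -mulrA -exprMn.
  by rewrite mulVf ?pnatr_eq0 // expr1n mulr1.
ring.
Qed.

Lemma neg_window m j :
  weight R (m + j) * (expR (- decay R (m + j) * (c0 * 16 ^+ m)) * (-1) ^+ (m + j)) =
  (-1) ^+ m.+1 * 4^-1 ^+ m * neg_term j.
Proof.
rewrite mulNr decay_shift_neg neg_termE /weight -addnS !exprD !exprS.
ring.
Qed.

(** The window consists of the terms with [m - K <= n < m]. Its nonnegative half appears in reverse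
    order, whence the reindexing. *)
Lemma alternating_small m K : (m <= K)%N ->
  alternating K (c0 * 16 ^+ m) = (-1) ^+ m.+1 * 4^-1 ^+ m *
    (\sum_(n < m) pos_term n + \sum_(j < K - m) neg_term j).
Proof.
move=> mK; rewrite /alternating mulrDr.
rewrite (@sum_ord_subn (fun k => weight R k *
  (expR (- decay R k * (c0 * 16 ^+ m)) * (-1) ^+ k)) m K mK).
congr (_ + _); rewrite mulr_sumr.
  rewrite (reindex_inj rev_ord_inj) /=; apply: eq_bigr => i _.
  have im := ltn_ord i; rewrite pos_window; last by lia.
  by congr (_ * pos_term _); lia.
by apply: eq_bigr => j _; exact: neg_window.
Qed.

Hypothesis Hq0 : Hq 16 c0 = 0.

Lemma alternating_le m K :
  4 ^+ m * `|alternating K (c0 * 16 ^+ m)| <=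
    2 * 4^-1 ^+ m + 2 * 4^-1 ^+ dist K m.
Proof.
have q : 4 ^+ m * 4^-1 ^+ m = 1 :> R.
  by rewrite -exprMn mulfV ?pnatr_eq0 // expr1n.
have p0 : 0 <= 4 ^+ m :> R by exact: exprn_ge0.
have w0 i : 0 <= 4^-1 ^+ i :> R by rewrite exprn_ge0 ?invr_ge0.
have [mK|Km] := leqP m K.
  rewrite (alternating_small mK) normr_sign_scale mulrA q mul1r.
  (* Here the zero of [Hq] enters: the limits of the two halves cancel, leaving only the two tails
     outside the window. *)
  have -> : \sum_(n < m) pos_term n + \sum_(j < K - m) neg_term j =
      (\sum_(n < m) pos_term n - limn (series pos_term)) +
      (\sum_(j < K - m) neg_term j - limn (series neg_term)).
    have : limn (series pos_term) + limn (series neg_term) = 0 by exact: Hq0.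
    move: (limn _) (limn _) => x y; lra.
  apply: le_trans (ler_normD _ _) _.
  have h1 := @geometric4_tail pos_term 1 m ler01
    (fun n => ltac:(by rewrite mul1r; exact: pos_term_le)).
  have h2 := @geometric4_tail neg_term 4^-1 (K - m) (ltac:(by rewrite invr_ge0)) neg_term_le.
  have -> : dist K m = (K - m)%N by rewrite /dist; lia.
  have := w0 m; have := w0 (K - m)%N; lra.
have -> : dist K m = (m - K)%N by rewrite /dist; lia.
have : `|alternating K (c0 * 16 ^+ m)| <=
    \sum_(k < K) 4^-1 ^+ m * (4^-1 ^+ (m - K) * 4^-1 ^+ (K - k.+1)).
  apply: le_trans (ler_norm_sum _ _ _) _; apply: ler_sum => k _.
  have kK := ltn_ord k.
  rewrite pos_window; last by lia.
  rewrite normr_sign_scale; apply: (ler_wpM2l (w0 m)).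
  apply: le_trans (pos_term_le _) _; rewrite -exprD.
  by have -> : (m - k.+1 = m - K + (K - k.+1))%N by lia.
move=> /(ler_wpM2l p0) h; apply: le_trans h _.
rewrite -mulr_sumr mulrA q mul1r -mulr_sumr (reindex_inj rev_ord_inj) /=.
have -> : \sum_(j < K) (4^-1 : R) ^+ (K - (K - j.+1).+1) = \sum_(j < K) 4^-1 ^+ j.
  by apply: eq_bigr => j _; have := ltn_ord j => jK; congr (_ ^+ _); lia.
have := ler_wpM2l (w0 (m - K)%N) (geometric4_sum_le R K).
have := w0 m; have := w0 (m - K)%N; lra.
Qed.

Lemma expRN_lipschitz (x y : R) : 0 <= x -> x <= y ->
  `|expR (- y) - expR (- x)| <= y - x.
Proof.
move=> x0 xy; rewrite distrC ger0_norm ?subr_ge0 ?ler_expR ?lerN2 //.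
have h1 := expR_ge1Dx (x - y).
have -> : expR (- y) = expR (- x) * expR (x - y) by rewrite -expRD; congr expR; ring.
have h2 : expR (- x) <= 1 by rewrite expR_le1 oppr_le0.
have h3 := ltW (expR_gt0 (- x)).
have h4 : expR (x - y) <= 1 by rewrite expR_le1 subr_le0.
have -> : expR (- x) - expR (- x) * expR (x - y) = expR (- x) * (1 - expR (x - y)) by ring.
apply: (@le_trans _ _ (1 - expR (x - y))); last by lra.
by rewrite ler_piMl // subr_ge0.
Qed.

(** The weights sum to at most [1/3] and the decay rates are at most 1, so the Lipschitz constant
    does not depend on [K]. *)
Lemma alternating_lipschitz K s t : 0 <= s -> s <= t ->
  `|alternating K t - alternating K s| <= t - s.
Proof.
move=> s0 st; rewrite /alternating -sumrB.
have d0 : 0 <= t - s by rewrite subr_ge0.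
apply: le_trans (ler_norm_sum _ _ _) _.
apply: (@le_trans _ _ (\sum_(k < K) weight R k * (t - s))); last first.
  rewrite -mulr_suml; have := ler_wpM2r d0 (sum_weight_le R K); lra.
apply: ler_sum => k _; rewrite -mulrBr -mulrBl !normrM normr_signX mulr1.
have w0 := ltW (weight_gt0 R k); have e0 := ltW (decay_gt0 R k).
rewrite (ger0_norm w0); apply: (ler_wpM2l w0).
rewrite !mulNr; apply: le_trans (expRN_lipschitz (mulr_ge0 e0 s0) (ler_wpM2l e0 st)) _.
rewrite -mulrBr ler_piMl // /decay exprn_ile1 ?invr_ge0 // invf_le1 ?ler1n //.
Qed.

(** Moving away from [c0 16^m] inside a block costs at most [16^-m], that is [4^-m] after scaling by
    [4^m], the order of the truncation error. The constants come from
    [(3 x + 2 y)^2 <= 18 x^2 + 8 y^2] and [x, y <= 1]; the factor [16^m] is the size of the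
    block. *)
Lemma alternating_point m l K : (l <= 16 ^ m)%N ->
  16 ^+ m * alternating K (time_point c0 m l) ^+ 2 <=
    18 * 4^-1 ^+ m + 8 * 4^-1 ^+ dist K m.
Proof.
move=> lm; have /andP[d0 d1] := time_point_bounds c0 lm.
have /andP[c1 _] := c0_bounds.
have p0 : 0 <= 4 ^+ m :> R by exact: exprn_ge0.
have p1 : 0 <= 16 ^+ m :> R by exact: exprn_ge0.
have s0 : 0 <= c0 * 16 ^+ m by rewrite mulr_ge0 //; lra.
have st : c0 * 16 ^+ m <= time_point c0 m l by rewrite -subr_ge0.
have h := alternating_lipschitz K s0 st.
have h' := le_trans h d1.
have q : 4 ^+ m * 16%:R ^- m = 4^-1 ^+ m :> R.
  by rewrite -exprVn -exprMn; congr (_ ^+ _); field.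
have w0 i : 0 <= 4^-1 ^+ i :> R by rewrite exprn_ge0 ?invr_ge0.
have w1 i : 4^-1 ^+ i <= 1 :> R by rewrite exprn_ile1 ?invr_ge0 // invf_le1 ?ler1n.
have hm : 4 ^+ m * `|alternating K (time_point c0 m l)| <=
    3 * 4^-1 ^+ m + 2 * 4^-1 ^+ dist K m.
  have := ler_wpM2l p0 h'; rewrite q => h2.
  have h3 := alternating_le m K.
  have := ler_wpM2l p0 (ler_normD (alternating K (time_point c0 m l) -
    alternating K (c0 * 16 ^+ m)) (alternating K (c0 * 16 ^+ m))).
  by rewrite subrK mulrDr; lra.
have -> : 16 ^+ m * alternating K (time_point c0 m l) ^+ 2 =
    (4 ^+ m * `|alternating K (time_point c0 m l)|) ^+ 2.
  rewrite exprMn real_normK ?num_real // -exprM mulnC exprM; congr (_ ^+ _ * _); ring.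
apply: (@le_trans _ _ ((3 * 4^-1 ^+ m + 2 * 4^-1 ^+ dist K m) ^+ 2)).
  by apply: lerXn2r; rewrite ?nnegrE ?addr_ge0 ?mulr_ge0.
move: (4^-1 ^+ m) (w0 m) (w1 m) (4^-1 ^+ dist K m) (w0 (dist K m)) (w1 (dist K m)).
move=> x x0 x1 y y0 y1.
have hx : x ^+ 2 <= x by rewrite expr2 ler_piMl.
have hy : y ^+ 2 <= y by rewrite expr2 ler_piMl.
have := sqr_ge0 (3 * x - 2 * y); lra.
Qed.

(** The origin gives at most 1 and the blocks at most [18 * 4/3 + 8 * 8/3], less than 49 in all for
    every [K]. *)
Lemma alternating_sum_le K M :
  \sum_(t <- time_list c0 M) alternating K t ^+ 2 <= 50.
Proof.
rewrite big_time_list.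
have w0 i : 0 <= 4^-1 ^+ i :> R by rewrite exprn_ge0 ?invr_ge0.
have h0 : alternating K 0 ^+ 2 <= 1.
  rewrite -real_normK ?num_real // exprn_ile1 //.
  apply: le_trans (ler_norm_sum _ _ _) _.
  apply: (@le_trans _ _ (\sum_(k < K) weight R k)).
    apply: ler_sum => k _; rewrite mulr0 expR0 mul1r normrM normr_signX mulr1.
    by rewrite ger0_norm // ltW // weight_gt0.
  have := sum_weight_le R K; lra.
have hB : \sum_(m < M) \sum_(t <- time_block c0 m) alternating K t ^+ 2 <=
    \sum_(m < M) (18 * 4^-1 ^+ m + 8 * 4^-1 ^+ dist K m).
  apply: ler_sum => m _; rewrite big_map.
  have p : 0 < 16 ^+ m :> R by exact: exprn_gt0.
  apply: (@le_trans _ _ (\sum_(l <- iota 1 (16 ^ m))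
      ((18 * 4^-1 ^+ m + 8 * 4^-1 ^+ dist K m) / 16 ^+ m))).
    rewrite big_seq [leRHS]big_seq; apply: ler_sum => l.
    rewrite mem_iota add1n ltnS => /andP[_ lm].
    by rewrite ler_pdivlMr // mulrC; exact: alternating_point.
  rewrite big_const_seq count_predT size_iota iter_addr_0 -[leLHS]mulr_natr natrX.
  by rewrite divfK // gt_eqF.
rewrite big_split -!mulr_sumr /= in hB.
have hd : \sum_(m < M) (4^-1 : R) ^+ dist K m <= 4 / 3 + 4 / 3.
  (* The range is enlarged so that it contains the centre [K], as [sum_dist_le] requires. *)
  apply: (@le_trans _ _ (\sum_(m < M + K.+1) (4^-1 : R) ^+ dist K m)).
    by rewrite big_split_ord /= lerDl sumr_ge0.
  by apply: (sum_dist_le w0 (geometric4_sum_le R)); lia.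
have := geometric4_sum_le R M; lra.
Qed.

Definition test_vector K : l2 R := l2_fin K (fun k => ((-1) ^+ k)%:C%C).

Lemma test_vector_observation K t : 0 <= t ->
  rnorm (observe (semigroup t (test_vector K)) : l2_hilbert R) ^+ 2 =
  alternating K t ^+ 2.
Proof.
move=> t0; rewrite nsq_observation //.
have -> : response t (fun k => complex.Im (test_vector K k)) = 0.
  rewrite /response -(@rsum0 R); congr rsum; apply/funext => k.
  by rewrite l2_finE; case: ifP => _ /=; rewrite !mulr0.
have -> : response t (fun k => complex.Re (test_vector K k)) = alternating K t.
  rewrite /response (rsum_finite (K := K) _).2.
    by apply: eq_bigr => k _; rewrite l2_finE ltn_ord.
  by move=> k Kk; rewrite l2_finE ltnNge Kk /= !mulr0.
by rewrite expr0n addr0.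
Qed.

Lemma test_vector_norm K : l2nsq (test_vector K) = K%:R.
Proof.
rewrite l2nsq_fin (eq_bigr (fun=> 1)).
  by rewrite sumr_const card_ord.
by move=> k _; rewrite nsq_real sqrr_sign.
Qed.

(** A lower constant [a] would give [a * K <= 50] for every [K], since the test vector has squared
    norm [K] and bounded observed energy. *)
Lemma not_observable_on_time_set :
  ~ exactly_observable (H := l2_hilbert R) (Y := l2_hilbert R)
    (fun t x => observe (op_pow (H := l2_hilbert R) (@diag_cfc R) t x))
    (time_set 16 c0).
Proof.
move=> [a [b [a0 _ hab]]].
have aK K : a * K%:R <= 50.
  have [h _] := hab (test_vector K).
  rewrite rnorm_l2 test_vector_norm in h.
  rewrite -lee_fin; apply: le_trans h _.
  have -> : \esum_(t in time_set 16 c0) (rnorm (observe (op_pow (H := l2_hilbert R)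
      (@diag_cfc R) t (test_vector K)) : l2_hilbert R) ^+ 2)%:E =
      \esum_(t in time_set 16 c0) (alternating K t ^+ 2)%:E.
    apply: eq_esum => t Tt; congr EFin; apply: test_vector_observation.
    exact: (time_set_ge0 c0_bounds Tt).
  apply: (@esum_le_seq _ _ (time_list c0)).
  - by move=> t; exact: sqr_ge0.
  - by move=> t /(time_setP c0).
  - by move=> M N; exact: sub_time_list.
  - exact: alternating_sum_le.
have := aK (Num.truncn (50 / a)).+1.
rewrite mulrC -ler_pdivlMr // leNgt => /negP; apply.
exact: truncnS_gt.
Qed.

End AlternatingSums.

Theorem theorem3p6 (R : realType) (c0 : R) :
  1 < c0 < 16 -> Hq 16 c0 = 0 ->
  let T := time_set 16 c0 in
  [/\ T 0,
      exists c c' R0 : R, [/\ 0 < c, c <= c', 0 < R0 & forall r : R, R0 <= r ->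
        c * r <= (counting_function T r)%:R <= c' * r],
      exists c c' : R, [/\ 0 < c, 0 < c' & forall r : R, 0 < r < 1 ->
        (c%:E <= (1 - r ^+ 2)%:E * (\esum_(t in T) (r `^ (2 * t))%:E) <= c'%:E)%E]
    & ~ universal_time_sets T].
Proof.
move=> c01 H0 T; split; first by left.
- exists (16^-1 ^+ 3), 3, (16 * 16); split.
  + by rewrite exprn_gt0 // invr_gt0.
  + by apply: (@le_trans _ _ 1); [rewrite exprn_ile1 ?invr_ge0 // invf_le1 ?ler1n|lra].
  + by lra.
  move=> r r1; rewrite counting_time_set_ge // counting_time_set_le //; lra.
- exists (expR (- 34) / 16), 4; split; first by rewrite divr_gt0 ?expR_gt0.
    by lra.
  by move=> r r01; rewrite abel_mean_ge // abel_mean_le.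
move=> [_ univ]; apply: (not_observable_on_time_set c01 H0).
apply: (univ (l2_hilbert R) (l2_hilbert R) (@diag_op R) (@observe R) (@diag_cfc R)).
- exact: l2_separable.
- exact: l2_separable.
- exact: diag_positive (@eigenvalue01 R).
- exact: observe_bounded.
- exact: diag_calculusP (@eigenvalue01 R) (@eigenvalue_cvg R).
- exact: natural_observable.
Qed.
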